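(* Let $m\ge2$, $\tau\in S_m$, and let $L(\tau)$ denote the Stanley–Wilf limit of $\tau$. Let $l\ge2$ be fixed and let $\{k_n\}$ be an arbitrary sequence of integers satisfying $1\le k_n\le n-l+1$. (i) Assume that $\tau$ satisfies at least one of the following three conditions: C1. there is at least one of the two patterns $12$ and $21$ that $\tau$ does not contain tightly; C2. $\tau_1\in\{1,m\}$ or $\tau_m\in\{1,m\}$; C3. $m\ge6$, $\{\tau_1,\tau_2,\tau_{m-1},\tau_m\}$ is a set of four consecutive numbers, and $\tau$ contains exactly one tight occurrence of $12$ and exactly one tight occurrence of $21$, which are in positions $1$ and $2$, and positions $m-1$ and $m$, in either order. Then $$\limsup_{n\to\infty}P_n^{\mathrm{av}(\tau)}(A^{(n)}_{l;k_n})\le\frac{|S_l(\tau)|}{(L(\tau))^{l-1}}.$$ (ii) Assume that $\tau$ is cluster-free. Then $$\lim_{n\to\infty}P_n^{\mathrm{av}(\tau)}(A^{(n)}_{l;k_n})=\frac{|S_l(\tau)|}{(L(\tau))^{l-1}}.$$ In particular, this limit equals $\dfrac{l!}{(L(\tau))^{l-1}}$ if $l<m$, and equals $\dfrac{m!-1}{(L(\tau))^{m-1}}$ if $l=m$. (iii) Assume that there is at least one of the two patterns $12$ and $21$ that $\tau$ does not contain tightly. Then $$\liminf_{n\to\infty}P_n^{\mathrm{av}(\tau)}(A^{(n)}_{l;k_n})\ge\frac1{(L(\tau))^{l-1}}.$$ If in fact $\tau$ contains tightly neither $12$ nor $21$, then $$\liminf_{n\to\infty}P_n^{\mathrm{a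v}(\tau)}(A^{(n)}_{l;k_n})\ge\frac2{(L(\tau))^{l-1}}.$$
   Context: $S_n$ is the set of permutations of $[n]=\{1,\dots,n\}$, written $\sigma=\sigma_1\sigma_2\cdots\sigma_n$. For $l\in\{2,\dots,n-1\}$ and $k\ge1$ with $k+l-1\le n$, $A^{(n)}_{l;k}\subset S_n$ is the set of $\sigma\in S_n$ for which there exists $a$ with $\{k,k+1,\dots,k+l-1\}=\{\sigma_a,\sigma_{a+1},\dots,\sigma_{a+l-1}\}$. For $\tau\in S_m$ with $2\le m\le n$, $\sigma\in S_n$ contains $\tau$ as a pattern if there are indices $1\le i_1<\cdots<i_m\le n$ such that for all $1\le j,j'\le m$, $\sigma_{i_j}<\sigma_{i_{j'}}$ if and only if $\tau_j<\tau_{j'}$; otherwise $\sigma$ avoids $\tau$. $S_n(\tau)$ is the set of $\sigma\in S_n$ avoiding $\tau$; if $n<m$, $S_n(\tau)=S_n$. $P_n^{\mathrm{av}(\tau)}$ is the uniform probability measure on $S_n(\tau)$, so $P_n^{\mathrm{av}(\tau)}(A)=|A\cap S_n(\tau)|/|S_n(\tau)|$ for $A\subset S_n$. The Stanley–Wilf limit is $L(\tau)=\lim_{n\to\infty}|S_n(\tau)|^{1/n}$, which is known to exist and be finite for every $\tau$ (the Stanley–Wilf conjecture, proved by Marcus and Tardos). $\tau\in S_m$ contains $12$ tightly (in positions $i$ and $i+1$) if for some $i,h$ one has $\tau_i=h$ and $\tau_{i+1}=h+1$; it contains $21$ tightly (in positions $i$ and $i+1$) if for some $i,h$ one has $\tau_i=h+1$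 and $\tau_{i+1}=h$. $\tau\in S_m$ is cluster-free if $\tau\notin A^{(m)}_{l';k'}$ for all $l'\in\{2,\dots,m-1\}$ and all $k'\in\mathbb{N}$, $k'\ge1$, with $k'+l'-1\le m$. *)

(* Defs.v *)
(* A permutation s of {1, ..., n} is an element of 'S_n, the permutations of
   {0, ..., n-1}: the one-line entry in position i.+1 is (s i).+1.
   Parameters that are positions or values are 1-based; the shift .+1 is
   always written out. *)
From mathcomp Require Import all_boot all_order all_fingroup all_algebra.
From mathcomp Require Import all_classical all_reals all_analysis.

Set Implicit Arguments.
Unset Strict Implicit.
Unset Printing Implicit Defensive.

Import Order.TTheory GRing.Theory Num.Theory.
Import numFieldNormedType.Exports.

Local Open Scope ring_scope.

(* In clusters the block of positions is a.+1, ..., a + l, and [a + l <= n]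
   keeps it inside {1, ..., n}.  For values no such condition is needed: if
   {k, ..., k+l-1} is not contained in {1, ..., n}, the second set has fewer
   than l elements and there is no such s (for l > 0). *)
Definition clusters (n l k : nat) : {set 'S_n} :=
  [set s : 'S_n | [exists a : 'I_n, (a + l <= n)%N &&
     ([set s i | i : 'I_n & (a <= i < a + l)%N]
        == [set v : 'I_n | (k <= v.+1 < k + l)%N])]].

Definition contains_pattern (n m : nat) (s : 'S_n) (tau : 'S_m) : bool :=
  [exists f : {ffun 'I_m -> 'I_n},
    [forall j : 'I_m, forall j' : 'I_m, (j < j')%N ==> (f j < f j')%N] &&
    [forall j : 'I_m, forall j' : 'I_m,
       (s (f j) < s (f j'))%N == (tau j < tau j')%N]].

Definition avoiders (m : nat) (tau : 'S_m) (n : nat) : {set 'S_n} :=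
  [set s : 'S_n | ~~ contains_pattern s tau].

Definition Pav (R : realType) (m : nat) (tau : 'S_m) (n : nat)
    (A : {set 'S_n}) : R :=
  #|A :&: avoiders tau n|%:R / #|avoiders tau n|%:R.

Definition stanley_wilf (R : realType) (m : nat) (tau : 'S_m) : R :=
  limn (fun n : nat => (#|avoiders tau n|%:R : R) `^ (n%:R^-1)).

Definition tight12_at (m : nat) (tau : 'S_m) (p : nat) : Prop :=
  exists i j : 'I_m,
    [/\ i.+1 = p, j = i.+1 :> nat & tau j = (tau i).+1 :> nat].

Definition tight21_at (m : nat) (tau : 'S_m) (p : nat) : Prop :=
  exists i j : 'I_m,
    [/\ i.+1 = p, j = i.+1 :> nat & tau i = (tau j).+1 :> nat].

Definition tight12 (m : nat) (tau : 'S_m) : Prop := exists p, tight12_at tau p.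

Definition tight21 (m : nat) (tau : 'S_m) : Prop := exists p, tight21_at tau p.

Definition condC1 (m : nat) (tau : 'S_m) : Prop :=
  ~ tight12 tau \/ ~ tight21 tau.

Definition condC2 (m : nat) (tau : 'S_m) : Prop :=
  exists i : 'I_m,
    (i.+1 = 1%N \/ i.+1 = m) /\ ((tau i).+1 = 1%N \/ (tau i).+1 = m).

Definition condC3 (m : nat) (tau : 'S_m) : Prop :=
  [/\ (6 <= m)%N,
      exists h : nat,
        [set tau i | i : 'I_m & i.+1 \in [:: 1; 2; m - 1; m]%N]
          = [set v : 'I_m | (h <= v.+1 < h + 4)%N]
    & ((forall p, tight12_at tau p <-> p = 1%N) /\
       (forall p, tight21_at tau p <-> p = (m - 1)%N)) \/
      ((forall p, tight21_at tau p <-> p = 1%N) /\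
       (forall p, tight12_at tau p <-> p = (m - 1)%N))].

Definition cluster_free (m : nat) (tau : 'S_m) : Prop :=
  forall l k : nat, (2 <= l <= m - 1)%N -> (1 <= k)%N -> (k + l - 1 <= m)%N ->
    tau \notin clusters m l k.

(* Main.v *)
(* A proof through the ratio limit |S_n(tau)| / |S_(n+1)(tau)| -> 1 / L.

   Contracting the block of a clustered permutation gives a pair in
   S_(n-l+1)(tau) x S_l(tau), and this map is injective for fixed k; it is onto
   when tau is cluster-free, while blocks 12...l (l...21) may always be inserted
   when tau contains no tight 12 (21).  Hence everything follows from the ratio
   limit.

   For the ratio limit let a_n = |S_n(tau)|.  In each of the cases C1-C3 there
   are n ways to insert one entry into a permutation of S_n(tau), such that
   the number d of ways in which a permutation arises satisfies
   d(child) <= d(parent) + 3.  Then sum d = n a_n over S_(n+1)(tau), and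
   Cauchy-Schwarz for d on S_(n+2)(tau) gives, with r_n = a_n / a_(n+1),
     (n + 1) r_(n+1) <= n r_n + 3.
   So r_n increases slowly; as a_(p+q) >= a_p a_q makes the geometric means of
   the r_n converge, r_n converges to the same limit.

   The finiteness of L (Marcus-Tardos) is not used: for superexponential growth
   limn returns 0, and with 0^-1 = 0 all the limits are still correct. *)

Require Import Defs.
From mathcomp Require Import all_boot all_order all_fingroup all_algebra.
From mathcomp Require Import all_classical all_reals all_analysis.
From mathcomp Require Import zify ring lra.

Set Implicit Arguments.
Unset Strict Implicit.
Unset Printing Implicit Defensive.

Import Order.TTheory GRing.Theory Num.Theory.
Import numFieldNormedType.Exports.

(** The insertions are as follows. Under C1 an entry is doubled to a tight 12 or 21, of a kind that
    [tau] lacks. Under C2, up to symmetry, a new value is put just below the minimum of a prefix.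
    Under C3 an entry is doubled to 12 where this is allowed and to 21 otherwise. In each case a
    permutation shows by marked positions how it can have arisen, and d counts the marks.

    The constant 3 is the number of positions within distance 1 of the insertion; every other mark
    of the child has to survive the deletion of the new entry. This is the delicate point of C3,
    where a 21 is marked only if the 12 was forbidden: being forbidden must not depend on the
    deleted entry.

    Cauchy-Schwarz here says that the mean of d is at most its size-biased mean. The mean over
    S_(n+2)(tau) is (n + 1) r_(n+1). The size-biased mean is the mean of d over the children of a
    uniform parent at a uniform position, hence at most n r_n + 3. *)

(* The values of s on nat, so that lia applies; it is the identity from n on. *)
Definition entry (n : nat) (s : 'S_n) (x : nat) : nat :=
  if insub x is Some i then s i else x.

Lemma entry_ord n (s : 'S_n) (i : 'I_n) : entry s i = s i.
Proof. by rewrite /entry valK. Qed.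

Lemma entryE n (s : 'S_n) x (hx : x < n) : entry s x = s (Ordinal hx).
Proof. by rewrite -entry_ord. Qed.

Lemma entry_lt n (s : 'S_n) x : x < n -> entry s x < n.
Proof. by move=> hx; rewrite entryE. Qed.

Lemma entry_inj n (s : 'S_n) x y :
  x < n -> y < n -> entry s x = entry s y -> x = y.
Proof.
move=> hx hy; rewrite !entryE.
by move=> /val_inj /perm_inj [].
Qed.

Lemma entry_surj n (s : 'S_n) v : v < n -> exists2 x, x < n & entry s x = v.
Proof.
move=> hv; exists ((s^-1)%g (Ordinal hv)) => //.
by rewrite (entry_ord s ((s^-1)%g (Ordinal hv))) permKV.
Qed.

Lemma entry_ext n (s t : 'S_n) :
  (forall x, x < n -> entry s x = entry t x) -> s = t.
Proof. by move=> st; apply/permP=> i; apply: val_inj; rewrite /= -!entry_ord st. Qed.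

Lemma card_ltn_ord n v : v <= n -> #|[set w : 'I_n | w < v]| = v.
Proof.
move=> hv; rewrite -[RHS]card_ord.
have -> : [set w : 'I_n | w < v] = widen_ord hv @: [set: 'I_v].
  apply/setP => w; rewrite inE; apply/idP/imsetP => [h|[u _ ->] //=].
  by exists (Ordinal h) => //; apply: val_inj.
rewrite card_imset ?cardsT //; by move=> u w [] /val_inj.
Qed.

Lemma card_below n (s : 'S_n) (i : 'I_n) : #|[set j | s j < s i]| = s i.
Proof.
rewrite -[RHS](@card_ltn_ord n (s i)); last exact: ltnW.
rewrite -[RHS](card_preimset [set w : 'I_n | w < s i] (@perm_inj _ s)).
by apply: eq_card => j; rewrite !inE.
Qed.

(** By [card_below] a value is the number of smaller entries, so the comparisons determine the
    permutation. *)
Lemma entry_cmp_ext n (s t : 'S_n) :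
  (forall x y, x < n -> y < n ->
    (entry s x < entry s y) = (entry t x < entry t y)) -> s = t.
Proof.
move=> st; apply/permP => i; apply: val_inj.
rewrite /= -card_below -[RHS]card_below; apply: eq_card => j.
by rewrite !inE -!entry_ord st.
Qed.

(* The identity if w does not permute 0, ..., n - 1. *)
Definition mkperm n (w : nat -> nat) : 'S_n :=
  if @injectiveP _ _ (fun i : 'I_n => insubd i (w i)) is ReflectT h
  then perm h else 1%g.

Lemma mkpermE n (w : nat -> nat) x :
  (forall x, x < n -> w x < n) ->
  (forall x y, x < n -> y < n -> w x = w y -> x = y) ->
  x < n -> entry (mkperm n w) x = w x.
Proof.
move=> wn winj hx; rewrite entryE /mkperm.
case: injectiveP => [h|[]]; first by rewrite permE val_insubd /= wn.
move=> i j /(congr1 val); rewrite !val_insubd !wn // => /winj e.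
by apply: val_inj; apply: e.
Qed.

(** * Occurrences of a pattern *)

Section Occurrences.

Variables (m : nat) (tau : 'S_m).

(** The bounds allow copies of a segment of [tau]: condition C3 works with copies that lack the
    first or the last entry. *)
Definition occ n (s : 'S_n) lo hi (f : nat -> nat) :=
  [/\ forall j, lo <= j < hi -> f j < n,
      forall j j', lo <= j -> j < j' -> j' < hi -> f j < f j'
    & forall j j', lo <= j < hi -> lo <= j' < hi ->
        (entry s (f j) < entry s (f j')) = (entry tau j < entry tau j')].

Lemma contains_occ n (s : 'S_n) :
  contains_pattern s tau <-> exists f, occ s 0 m f.
Proof.
split=> [/existsP [f /andP [/'forall_forallP f1 /'forall_forallP f2]]|[f [f0 f1 f2]]].
  exists (fun j => if insub j is Some i then (f i : nat) else 0).
  split=> [j /andP [_ hj]|j j' _ hjj hj'|j j' /andP [_ hj] /andP [_ hj']].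
  - by rewrite insubT.
  - have hj := ltn_trans hjj hj'; rewrite !insubT.
    by have /implyP -> := f1 (Ordinal hj) (Ordinal hj').
  - rewrite !insubT /= !entry_ord (eqP (f2 (Ordinal hj) (Ordinal hj'))).
    by rewrite -!entry_ord.
apply/existsP; have h (j : 'I_m) : f j < n by apply: f0 => /=.
exists [ffun j => Ordinal (h j)]; apply/andP; split; apply/'forall_forallP => j j'.
- by apply/implyP=> jj'; rewrite !ffunE /=; apply: f1.
- by rewrite !ffunE -!entry_ord /= f2 //=.
Qed.

Lemma avoidersP n (s : 'S_n) :
  reflect (forall f, ~ occ s 0 m f) (s \in avoiders tau n).
Proof.
rewrite inE; apply: (iffP negP) => [h f of_|h /contains_occ [f]]; last exact: h.
by apply: h; apply/contains_occ; exists f.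
Qed.

(** Most avoidance proofs below move a hypothetical occurrence along a map [q] of positions into a
    permutation known to avoid [tau]. *)
Lemma occ_map n n' (s : 'S_n) (s' : 'S_n') lo hi f q :
  occ s lo hi f ->
  (forall j, lo <= j < hi -> q (f j) < n') ->
  (forall j j', lo <= j -> j < j' -> j' < hi -> q (f j) < q (f j')) ->
  (forall j j', lo <= j < hi -> lo <= j' < hi ->
    (entry s' (q (f j)) < entry s' (q (f j'))) =
    (entry s (f j) < entry s (f j'))) ->
  occ s' lo hi (q \o f).
Proof.
by move=> [f0 f1 f2] q0 q1 q2; split=> // j j' hj hj'; rewrite /= q2 // f2.
Qed.

End Occurrences.

(** * Insertion and deletion of one entry *)

Section InsertDelete.

Implicit Types (n i x : nat).

(* The new entry sits at position i + 1, right after position i; skip and coll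
   translate positions without it to positions with it and back. *)
Definition skip i x := x + (i < x).
Definition coll i x := x - (i < x).

Definition ins n (s : 'S_n) i v : 'S_n.+1 :=
  mkperm n.+1 (fun x => if x == i.+1 then v else
    let y := entry s (coll i x) in y + (v <= y)).

Definition del n (s : 'S_n.+1) i : 'S_n :=
  mkperm n (fun x => let y := entry s (skip i x) in y - (entry s i.+1 < y)).

Lemma insE n (s : 'S_n) i v x : i < n -> v <= n -> x <= n ->
  entry (ins s i v) x = if x == i.+1 then v else
    entry s (coll i x) + (v <= entry s (coll i x)).
Proof.
move=> hi hv hx; rewrite /ins mkpermE // => {x hx} [x hx|x y hx hy].
  case: eqP => [//|hx']; have := @entry_lt n s (coll i x); rewrite /coll; lia.
have := @entry_inj n s (coll i x) (coll i y).
by rewrite /coll; case: eqP; case: eqP; lia.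
Qed.

Lemma ins_new n (s : 'S_n) i v : i < n -> v <= n -> entry (ins s i v) i.+1 = v.
Proof. by move=> hi hv; rewrite insE ?eqxx. Qed.

Lemma ins_skip n (s : 'S_n) i v x : i < n -> v <= n -> x < n ->
  entry (ins s i v) (skip i x) = entry s x + (v <= entry s x).
Proof.
move=> hi hv hx; rewrite insE //; last by rewrite /skip; lia.
have -> : coll i (skip i x) = x by rewrite /coll /skip; lia.
by case: eqP => //; rewrite /skip; lia.
Qed.

Lemma delE n (s : 'S_n.+1) i x : i < n -> x < n ->
  entry (del s i) x =
    entry s (skip i x) - (entry s i.+1 < entry s (skip i x)).
Proof.
move=> hi hx; rewrite /del mkpermE // => {x hx} [x hx|x y hx hy].
  have := @entry_lt n.+1 s (skip i x); have := @entry_lt n.+1 s i.+1.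
  have := @entry_inj n.+1 s (skip i x) i.+1.
  rewrite /skip; lia.
have := @entry_inj n.+1 s (skip i x) (skip i y).
have := @entry_inj n.+1 s (skip i x) i.+1.
have := @entry_inj n.+1 s (skip i y) i.+1.
by rewrite /skip; lia.
Qed.

Lemma del_cmp n (s : 'S_n.+1) i x y : i < n -> x < n -> y < n ->
  (entry (del s i) x < entry (del s i) y) =
  (entry s (skip i x) < entry s (skip i y)).
Proof.
move=> hi hx hy; rewrite !delE //.
have := @entry_inj n.+1 s (skip i x) i.+1.
have := @entry_inj n.+1 s (skip i y) i.+1.
by rewrite /skip; lia.
Qed.

Lemma ins_cmp n (s : 'S_n) i v x y : i < n -> v <= n -> x < n -> y < n ->
  (entry (ins s i v) (skip i x) < entry (ins s i v) (skip i y)) =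
  (entry s x < entry s y).
Proof. by move=> hi hv hx hy; rewrite !ins_skip //; lia. Qed.

Lemma del_ins n (s : 'S_n) i v : i < n -> v <= n -> del (ins s i v) i = s.
Proof.
move=> hi hv; apply: entry_cmp_ext => x y hx hy.
by rewrite del_cmp // ins_cmp.
Qed.

Lemma ins_del n (s : 'S_n.+1) i : i < n -> ins (del s i) i (entry s i.+1) = s.
Proof.
move=> hi; have hv := @entry_lt n.+1 s i.+1 hi.
apply: entry_ext => x hx; rewrite insE //; case: eqP => [-> //|hx'].
have h : coll i x < n by rewrite /coll; lia.
rewrite delE //; have -> : skip i (coll i x) = x by rewrite /coll /skip; lia.
have ne : entry s x <> entry s i.+1 by move=> /entry_inj => /(_ hx hi).
case: (ltnP (entry s i.+1) (entry s x)) => ?; lia.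
Qed.

Lemma del_avoid m (tau : 'S_m) n (s : 'S_n.+1) i : i < n ->
  s \in avoiders tau n.+1 -> del s i \in avoiders tau n.
Proof.
move=> hi /avoidersP h; apply/avoidersP => f fo; case: (fo) => f0 f1 _.
apply: (h (skip i \o f)); apply: (occ_map fo) => [j hj|j j' h1 h2 h3|j j' hj hj'].
- by have := f0 j hj; rewrite /skip; lia.
- by have := f1 j j' h1 h2 h3; rewrite /skip; lia.
- by rewrite del_cmp // f0.
Qed.

Lemma del_del n (s : 'S_n.+2) i j : i < n.+1 -> j < n.+1 -> i != j ->
  del (del s i) (coll i j) = del (del s j) (coll j i).
Proof.
move=> hi hj ij; apply: entry_cmp_ext => x y hx hy.
have hci : coll i j < n by rewrite /coll; lia.
have hcj : coll j i < n by rewrite /coll; lia.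
have e z : skip i (skip (coll i j) z) = skip j (skip (coll j i) z).
  by move: ij; rewrite /skip /coll; lia.
by rewrite !del_cmp ?e // /skip; lia.
Qed.

End InsertDelete.

(** * The ratio inequality *)

(* v s i is the value inserted into s after position i, and M s' i says that
   s' arises in this way by insertion after position i. *)
Section RatioStep.

Variables (m : nat) (tau : 'S_m) (v : forall n, 'S_n -> nat -> nat).
Variable M : forall n, 'S_n -> nat -> bool.

Hypothesis insP : forall n (s : 'S_n) i, s \in avoiders tau n -> i < n ->
  [/\ v s i <= n, ins s i (v s i) \in avoiders tau n.+1
    & M (ins s i (v s i)) i].
Hypothesis markP : forall n (s : 'S_n.+1) i,
  s \in avoiders tau n.+1 -> i < n -> M s i -> v (del s i) i = entry s i.+1.
Hypothesis mark_del : forall n (s : 'S_n.+2) i j, s \in avoiders tau n.+2 ->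
  i < n.+1 -> j < n.+1 -> i.+1 < j \/ j.+1 < i ->
  M s i -> M s j -> M (del s i) (coll i j).

Let av n := #|avoiders tau n|.
Let d n (s : 'S_n) : nat := \sum_(i < n.-1) M s i.

Lemma sum_ins n (i : 'I_n) (F : 'S_n.+1 -> nat) :
  \sum_(s in avoiders tau n.+1 | M s i) F s =
  \sum_(s in avoiders tau n) F (ins s i (v s i)).
Proof.
rewrite (reindex_onto (fun s : 'S_n => ins s i (v s i)) (fun s => del s i)) /=.
  apply: eq_bigl => s; apply/idP/idP => [/andP [/andP [h _] /eqP <-]|h].
    exact: del_avoid.
  by have [h1 -> ->] := insP h (ltn_ord i); rewrite del_ins ?eqxx.
move=> s /andP [hs hM].
by rewrite markP // ins_del.
Qed.

(** Double counting: [insP] and [markP] match the pairs (parent, position) with the pairs (child,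
    mark). *)
Lemma sum_marks n (F : 'S_n.+1 -> nat) :
  \sum_(s in avoiders tau n.+1) d s * F s =
  \sum_(i < n) \sum_(s in avoiders tau n) F (ins s i (v s i)).
Proof.
under [RHS]eq_bigr => i _ do rewrite -sum_ins.
rewrite (exchange_big_dep (mem (avoiders tau n.+1))) /=; last by move=> ? ? _ /andP [].
apply: eq_bigr => s hs; rewrite big_distrl /= big_mkcond [RHS]big_mkcond /=.
by apply: eq_bigr => i _; rewrite hs; case: (M s i); rewrite ?mul0n ?mul1n.
Qed.

(** The map [coll i] carries the marks of the child away from the insertion injectively to marks of
    the parent. At most three are left, at [i - 1], [i] and [i + 1]. *)
Lemma marks_ins n (s : 'S_n.+1) i : s \in avoiders tau n.+1 -> i < n.+1 ->
  d (ins s i (v s i)) <= d s + 3.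
Proof.
case: n s => [|n] s hs hi.
  by rewrite /d /= big_ord_recl big_ord0; case: (M _ _) => /=; lia.
have [hv hav hM] := insP hs hi.
rewrite /d /=; set t := ins s i _ in hav hM *.
pose near := [set j : 'I_n.+2 | (i <= j.+1) && (j <= i.+1)].
rewrite (bigID (mem near)) /= addnC; apply: leq_add.
  pose A := [set j : 'I_n.+2 | (j \notin near) && M t j].
  pose B := [set j : 'I_n.+1 | M s j].
  have -> : \sum_(j < n.+2 | j \notin near) M t j = #|A|.
    rewrite -sum1_card big_mkcond [RHS]big_mkcond /=; apply: eq_bigr => j _.
    by rewrite [j \in A]inE; case: (j \notin near); case: (M t j).
  have -> : \sum_(j < n.+1) M s j = #|B|.
    rewrite -sum1_card [RHS]big_mkcond /=; apply: eq_bigr => j _.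
    by rewrite inE; case: (M s j).
  have far (j : 'I_n.+2) : j \in A -> i.+1 < j \/ j.+1 < i.
    by rewrite !inE => /andP [h _]; lia.
  rewrite -(card_in_imset (f := fun j : 'I_n.+2 => inord (coll i j) : 'I_n.+1)).
    apply/subset_leq_card/fintype.subsetP => j /imsetP [k hk ->]; rewrite inE.
    have hf := far k hk; move: hk; rewrite inE => /andP [_ hk].
    rewrite inordK; last by have := ltn_ord k; rewrite /coll; lia.
    rewrite -[s](del_ins _ hi hv); exact: mark_del.
  move=> j k /far hj /far hk /(congr1 val); rewrite /= !inordK.
  - by move=> e; apply: val_inj; move: e; rewrite /coll /=; lia.
  - by have := ltn_ord k; rewrite /coll; lia.
  - by have := ltn_ord j; rewrite /coll; lia.
have -> : 3 = size [:: i.-1; i; i.+1] by [].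
apply: (@leq_trans #|near|).
  by rewrite -sum1_card; apply: leq_sum => j _; case: (M t j).
rewrite cardE -(size_map val); apply: uniq_leq_size.
  by rewrite map_inj_uniq ?enum_uniq //; exact: val_inj.
move=> x /mapP [j]; rewrite mem_enum inE => hj ->; rewrite !inE /=; lia.
Qed.

Lemma ratio_step n : n.+1 * av n.+1 ^ 2 <= av n.+2 * (n * av n + 3 * av n.+1).
Proof.
have s1 k : \sum_(s in avoiders tau k.+1) d s = k * av k.
  have := @sum_marks k (fun=> 1); under eq_bigr do rewrite muln1.
  move=> /= ->; under eq_bigr do rewrite sum_nat_const muln1.
  by rewrite sum_nat_const card_ord.
(* One factor [d s] becomes the choice of a parent and a position; [marks_ins] bounds the other
   factor. *)
have s2 : \sum_(s in avoiders tau n.+2) d s ^ 2 <=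
    n.+1 * (n * av n + 3 * av n.+1).
  under eq_bigr do rewrite expnS expn1.
  rewrite sum_marks -[X in X * _](card_ord n.+1) -sum_nat_const; apply: leq_sum => i _.
  rewrite -s1 [3 * _]mulnC -sum_nat_const -big_split /=.
  by apply: leq_sum => s hs; apply: marks_ins.
(* Cauchy-Schwarz, by summing 2 d(s) d(t) <= d(s)^2 + d(t)^2 over all pairs. *)
have cs : (\sum_(s in avoiders tau n.+2) d s) ^ 2 <=
    av n.+2 * \sum_(s in avoiders tau n.+2) d s ^ 2.
  rewrite -(leq_pmul2l (isT : 0 < 2)) expnS expn1 big_distrlr /=.
  rewrite [2 * (av _ * _)](_ : _ = \sum_(s in avoiders tau n.+2)
     \sum_(t in avoiders tau n.+2) (d s ^ 2 + d t ^ 2)).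
    rewrite big_distrr; apply: leq_sum => s _; rewrite big_distrr.
    by apply: leq_sum => t _; rewrite (nat_Cauchy (d s) (d t)).
  under [RHS]eq_bigr do rewrite big_split /=.
  rewrite big_split /= sum_nat_const exchange_big /= sum_nat_const.
  by rewrite -/(av n.+2) mul2n addnn.
rewrite s1 in cs; have := leq_trans cs (leq_mul (leqnn _) s2).
rewrite mulnCA (_ : (n.+1 * av n.+1) ^ 2 = n.+1 * (n.+1 * av n.+1 ^ 2)) ?leq_pmul2l //.
by rewrite !expnS !expn0; lia.
Qed.

End RatioStep.

(** * Tight pairs: condition C1 *)

(** The inequality between r_(n+1) and r_n, multiplied by a_(n+1) a_(n+2). *)
Definition slow m (tau : 'S_m) := forall n,
  n.+1 * #|avoiders tau n.+1| ^ 2 <=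
  #|avoiders tau n.+2| * (n * #|avoiders tau n| + 3 * #|avoiders tau n.+1|).

Lemma entry_neq n (s : 'S_n) x y :
  x < n -> y < n -> x <> y -> entry s x <> entry s y.
Proof. by move=> hx hy xy /entry_inj; auto. Qed.

(* A tight 12 (b = true) or 21 (b = false) at positions i, i + 1. *)
Definition twin n (s : 'S_n) i (b : bool) :=
  (i.+1 < n) && (entry s i.+1 + ~~ b == entry s i + b).

(** A value strictly between the two entries would sit at a third position and separate them. *)
Lemma twin_of_cmp n (s : 'S_n) i : i.+1 < n ->
  (forall y, y < n -> y <> i -> y <> i.+1 ->
    (entry s i < entry s y) = (entry s i.+1 < entry s y)) ->
  twin s i (entry s i < entry s i.+1).
Proof.
move=> hi h; rewrite /twin hi /=.
have between u w : u < n -> w < n -> entry s u < (entry s u).+1 < entry s w ->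
    (u = i /\ w = i.+1) \/ (u = i.+1 /\ w = i) -> False.
  move=> hu hw /andP [_ uw] hc.
  have [y hy sy] : exists2 y, y < n & entry s y = (entry s u).+1.
    by apply: entry_surj; apply: ltn_trans uw _; exact: entry_lt.
  have yi : y <> i by move=> yi; rewrite yi in sy; case: hc => -[? ?]; subst; lia.
  have yi1 : y <> i.+1.
    by move=> yi1; rewrite yi1 in sy; case: hc => -[? ?]; subst; lia.
  by have := h y hy yi yi1; case: hc => -[? ?]; subst; lia.
have ne := @entry_neq n s i i.+1 (ltnW hi) hi (n_Sn i).
have b1 := between i i.+1 (ltnW hi) hi.
have b2 := between i.+1 i hi (ltnW hi).
case: (ltngtP (entry s i) (entry s i.+1)) => c; last by case: ne.
- case: (ltnP (entry s i).+1 (entry s i.+1)) => c'; last by lia.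
  by case: b1; [rewrite ltnSn c' | left].
- case: (ltnP (entry s i.+1).+1 (entry s i)) => c'; last by lia.
  by case: b2; [rewrite ltnSn c' | right].
Qed.

(** Since [coll i] sends both copies of a doubled entry to [i], only the comparison between the two
    copies is lost. *)
Lemma ins_cmp_coll n (s : 'S_n) i (b : bool) x y : i < n -> x <= n -> y <= n ->
  ~ (x = i /\ y = i.+1) -> ~ (x = i.+1 /\ y = i) ->
  (entry s (coll i x) < entry s (coll i y)) =
  (entry (ins s i (entry s i + b)) x < entry (ins s i (entry s i + b)) y).
Proof.
move=> hi hx hy n1 n2; have hb : entry s i + b <= n by have := entry_lt s hi; lia.
have ci : coll i i.+1 = i by rewrite /coll; lia.
rewrite !insE //; case: eqP => [ex|ex]; case: eqP => [ey|ey].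
- by rewrite ex ey; lia.
- have ne : entry s i <> entry s (coll i y).
    by apply: entry_neq; rewrite // /coll; lia.
  by rewrite ex ci; lia.
- have ne : entry s (coll i x) <> entry s i.
    by apply: entry_neq; rewrite // /coll; lia.
  by rewrite ey ci; lia.
- by lia.
Qed.

Section Twins.

Variables (m : nat) (tau : 'S_m).

Lemma occ_inj n (s : 'S_n) lo hi f j j' : occ tau s lo hi f ->
  lo <= j < hi -> lo <= j' < hi -> j <> j' -> f j <> f j'.
Proof.
case=> _ f1 _ hj hj' ne; case: (ltngtP j j') => // c.
- by have := f1 j j'; lia.
- by have := f1 j' j; lia.
Qed.

Lemma occ_lt n (s : 'S_n) lo hi f : hi <= m ->
  (forall j, lo <= j < hi -> f j < n) ->
  (forall j j', lo <= j -> j < j' -> j' < hi -> f j < f j' /\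
     (entry s (f j) < entry s (f j')) = (entry tau j < entry tau j')) ->
  occ tau s lo hi f.
Proof.
move=> hm f0 f1; split=> // [j j' h1 h2 h3|j j' hj hj'].
  by case: (f1 j j' h1 h2 h3).
case: (ltngtP j j') => [c|c|->]; last by rewrite !ltnn.
- by have [] := f1 j j'; lia.
- have [p q] : f j' < f j /\
      (entry s (f j') < entry s (f j)) = (entry tau j' < entry tau j).
    by apply: f1; lia.
  have := @entry_neq m tau j' j; have := @entry_neq n s (f j') (f j).
  by have := f0 j hj; have := f0 j' hj'; lia.
Qed.

Lemma occ_sub n (s : 'S_n) lo hi lo' hi' f : lo <= lo' -> hi' <= hi ->
  occ tau s lo hi f -> occ tau s lo' hi' f.
Proof.
move=> hl hh [f0 f1 f2]; split=> [j hj|j j' h1 h2 h3|j j' h1 h2].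
- by apply: f0; lia.
- by apply: f1; lia.
- by apply: f2; lia.
Qed.

(** The two copies are neighbours, so an occurrence using both uses them in consecutive roles. If
    this is excluded, [coll i] is injective on the occurrence. *)
Lemma occ_ins n (s : 'S_n) i (b : bool) lo hi f : i < n ->
  occ tau (ins s i (entry s i + b)) lo hi f ->
  (forall k, lo <= k -> k.+1 < hi -> f k = i -> f k.+1 = i.+1 -> False) ->
  occ tau s lo hi (coll i \o f).
Proof.
move=> hin fo hk; case: (fo) => f0 f1 _.
have nb j j' : lo <= j < hi -> lo <= j' < hi -> f j = i -> f j' = i.+1 -> False.
  move=> hj hj' ej ej'.
  have jj' : j < j'.
    case: (ltngtP j j') => // c; first by have := f1 j' j; lia.
    by move: ej'; rewrite -c ej; lia.
  case: (ltngtP j.+1 j') => c; [|lia|].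
    by have := f1 j j.+1; have := f1 j.+1 j'; lia.
  by apply: (hk j); rewrite ?c //; lia.
apply: (occ_map fo) => [j hj|j j' h1 h2 h3|j j' hj hj'].
- by have := f0 j hj; rewrite /coll; lia.
- have := f1 j j' h1 h2 h3; have := nb j j'; rewrite /coll; lia.
- have h1 := f0 j hj; have h2 := f0 j' hj'.
  apply: ins_cmp_coll => //.
    by move=> [e e']; apply: (nb j j').
  by move=> [e e']; apply: (nb j' j).
Qed.

(** No third entry separates the two copies. This makes [k] a tight pair of [tau] when the whole of
    [tau] is represented; for a segment, an entry of [tau] outside it might still separate. *)
Lemma occ_ins_twin n (s : 'S_n) i (b : bool) lo hi f k : i < n ->
  occ tau (ins s i (entry s i + b)) lo hi f ->
  lo <= k -> k.+1 < hi -> f k = i -> f k.+1 = i.+1 ->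
  (entry tau k < entry tau k.+1) = b /\
  (forall y, lo <= y < hi -> y <> k -> y <> k.+1 ->
    (entry tau k < entry tau y) = (entry tau k.+1 < entry tau y)).
Proof.
move=> hin fo h1 h2 fk fk1; case: (fo) => f0 f1 f2.
have hb : entry s i + b <= n by have := entry_lt s hin; lia.
have ci : coll i i.+1 = i by rewrite /coll; lia.
have ci' : coll i i = i by rewrite /coll; lia.
split.
  rewrite -f2; [|lia|lia]; rewrite fk fk1 !insE ?eqxx //; last by lia.
  by case: eqP; rewrite ?ci'; lia.
move=> y hy n1 n2; rewrite -(f2 k y) -1?(f2 k.+1 y) //; try lia.
have hfy := f0 y hy.
have := occ_inj fo hy _ n1; rewrite fk => /(_ ltac:(lia)) e1.
have := occ_inj fo hy _ n2; rewrite fk1 => /(_ ltac:(lia)) e2.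
have := @ins_cmp_coll n s i b i (f y); have := @ins_cmp_coll n s i b i.+1 (f y).
by rewrite ci ci'; lia.
Qed.

End Twins.

Lemma ins_twin n (s : 'S_n) i (b : bool) : i < n -> twin (ins s i (entry s i + b)) i b.
Proof.
move=> hi; have hb : entry s i + b <= n by have := entry_lt s hi; lia.
rewrite /twin ltnS hi ins_new // insE //; last by lia.
have -> : coll i i = i by rewrite /coll; lia.
by case: ifP => [/eqP|_]; case: b hb => /=; lia.
Qed.

Lemma twin_del_val n (s : 'S_n.+1) i (b : bool) : i < n -> twin s i b ->
  entry (del s i) i + b = entry s i.+1.
Proof.
move=> hi /andP [_ h]; rewrite delE //.
have -> : skip i i = i by rewrite /skip; lia.
by lia.
Qed.

Lemma twin_ins_del n (s : 'S_n.+1) i (b : bool) : i < n -> twin s i b ->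
  ins (del s i) i (entry (del s i) i + b) = s.
Proof. by move=> hi ht; rewrite (twin_del_val hi ht) ins_del. Qed.

Lemma twin_del n (s : 'S_n.+2) i j b : i < n.+1 -> j < n.+1 ->
  i.+1 < j \/ j.+1 < i -> twin s j b -> twin (del s i) (coll i j) b.
Proof.
move=> hi hj far /andP [_ h]; apply/andP; split.
  by rewrite /coll; lia.
rewrite !delE //; try by rewrite /coll; lia.
have -> : skip i (coll i j) = j by rewrite /skip /coll; lia.
have -> : skip i (coll i j).+1 = j.+1 by rewrite /skip /coll; lia.
have := @entry_neq n.+2 s i.+1 j; have := @entry_neq n.+2 s i.+1 j.+1.
by case: b h => /=; lia.
Qed.

(** Doubling an entry to 12 can create [tau] only through an occurrence that uses both copies, and
    these would form a tight 12 of [tau]. *)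
Lemma slow_no_tight12 m (tau : 'S_m) :
  (forall k, ~~ twin tau k true) -> slow tau.
Proof.
move=> nt; apply: (ratio_step (v := fun n s i => entry s i + true)
                              (M := fun n s i => twin s i true)).
- move=> n s i /avoidersP hs hi; split; last exact: ins_twin.
    by have := entry_lt s hi; lia.
  apply/avoidersP => f fo.
  apply: (hs (coll i \o f)); apply: (occ_ins hi fo) => k h1 h2 h3 h4.
  have [c1 c2] := occ_ins_twin hi fo h1 h2 h3 h4.
  have /negP := nt k; rewrite -c1; apply; exact: twin_of_cmp.
- by move=> n s i _; exact: twin_del_val.
- by move=> n s i j _ hi hj far _; exact: twin_del.
Qed.

(** * An extremal corner: condition C2 *)

Fixpoint runmin n (s : 'S_n) i :=
  if i is j.+1 then minn (runmin s j) (entry s i) else entry s 0.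

Lemma runmin_le n (s : 'S_n) i x : x <= i -> runmin s i <= entry s x.
Proof.
elim: i => [|i ih]; first by rewrite leqn0 => /eqP ->.
rewrite leq_eqVlt => /orP [/eqP -> | /ih h] /=; first exact: geq_minr.
exact: leq_trans (geq_minl _ _) h.
Qed.

Lemma runmin_ex n (s : 'S_n) i : exists2 x, x <= i & entry s x = runmin s i.
Proof.
elim: i => [|i [x hx ex]]; first by exists 0.
rewrite /=; case: (leqP (runmin s i) (entry s i.+1)) => c.
  by exists x; rewrite ?(leq_trans hx) // ex; apply/esym/minn_idPl.
by exists i.+1; rewrite //; apply/esym/minn_idPr/ltnW.
Qed.

Lemma runmin_eq n (s : 'S_n) i x r : x <= i -> entry s x = r ->
  (forall y, y <= i -> r <= entry s y) -> runmin s i = r.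
Proof.
move=> hx ex h; apply/eqP; rewrite eqn_leq -{1}ex runmin_le //=.
by have [y hy <-] := runmin_ex s i; apply: h.
Qed.

(* A new entry right after position i, with value just below the running
   minimum, can play only the role of the first entry of an occurrence, and
   there it may be replaced by that minimum. *)
Lemma slow_first_min m (tau : 'S_m) : 1 < m -> entry tau 0 = 0 -> slow tau.
Proof.
move=> hm t0; apply: (ratio_step (v := fun n s i => runmin s i)
  (M := fun n s i => runmin s i == (entry s i.+1).+1)).
- move=> n s i /avoidersP hs hi; have [p hp ep] := runmin_ex s i.
  have hv : runmin s i < n by rewrite -ep entry_lt //; lia.
  have hv' := ltnW hv; have before x : x <= i ->
      entry (ins s i (runmin s i)) x = (entry s x).+1.
    move=> hx; have := runmin_le s hx; rewrite insE //; last by lia.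
    have -> : coll i x = x by rewrite /coll; lia.
    by case: ifP => [/eqP|_]; lia.
  split=> //; last first.
    apply/eqP; rewrite ins_new //; apply: (runmin_eq hp).
      by rewrite before // ep.
    by move=> y hy; rewrite before // ltnS runmin_le.
  apply/avoidersP => f fo; case: (fo) => f0 f1 f2.
  have shift j : j < m -> i.+1 < f j ->
      [/\ coll i (f j) < n, i < coll i (f j) & skip i (coll i (f j)) = f j].
    by move=> hj hc; have := f0 j hj => h; split; rewrite /skip /coll; lia.
  case: (boolP [exists j : 'I_m, f j == i.+1]) => [/existsP [j /eqP fj]|].
    have j0 : j = 0 :> nat.
      apply/eqP; case: (posnP j) => // jp; have hj := ltn_ord j.
      have := f2 0 j; rewrite fj ins_new // t0.
      have /before -> : f 0 <= i by have := f1 0 j; lia.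
      have := @entry_neq m tau j 0; have := @runmin_le n s i (f 0).
      by have := f1 0 j; lia.
    rewrite j0 in fj.
    have late k : 0 < k -> k < m -> i.+1 < f k.
      by move=> h1 h2; rewrite -fj; apply: f1.
    apply: (hs (fun k => if k == 0 then p else coll i (f k))).
    apply: occ_lt => // [k hk|k k' _ h1 h2].
      case: (posnP k) => [_|kp] /=; first by lia.
      by have [] := shift _ hk (late k kp hk).
    have k'p : 0 < k' by lia.
    have [s1 s2 s3] := shift k' h2 (late k' k'p h2).
    have -> : (k' == 0) = false by lia.
    case: (posnP k) => [k0|kp] /=; rewrite ?k0.
      split; first by lia.
      rewrite -f2 //; last by lia.
      rewrite fj ins_new // -[in RHS]s3 ins_skip //.
      have := @entry_neq n s p (coll i (f k')); rewrite ep; lia.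
    have hk : k < m by lia.
    have [s4 s5 s6] := shift k hk (late k kp hk).
    split.
      by have := f1 k k'; have := late k; have := late k'; rewrite /coll; lia.
    by rewrite -f2 // -[in RHS]s3 -[in RHS]s6 ins_cmp.
  rewrite negb_exists => /forallP no.
  have nf j : j < m -> f j <> i.+1.
    by move=> hj; apply/eqP; exact: (no (Ordinal hj)).
  apply: (hs (coll i \o f)); apply: (occ_map fo) => [j hj|j j' h1 h2 h3|j j' hj hj'].
  + by have := f0 j hj; have := nf j hj; rewrite /coll; lia.
  + by have := f1 j j' h1 h2 h3; have := nf j; have := nf j'; rewrite /coll; lia.
  + have e k : k < m -> coll i (f k) < n /\ skip i (coll i (f k)) = f k.
      move=> hk; have := f0 k hk; have := nf k hk; rewrite /skip /coll; lia.
    have [e1 e2] := e j hj; have [e3 e4] := e j' hj'.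
    by rewrite -[in RHS]e2 -[in RHS]e4 ins_cmp.
- move=> n s i _ hi /eqP hM; have [p hp ep] := runmin_ex s i.
  have before x : x <= i -> entry (del s i) x = (entry s x).-1.
    move=> hx; have := runmin_le s hx; rewrite delE //; last by lia.
    have -> : skip i x = x by rewrite /skip; lia.
    by lia.
  apply: (runmin_eq hp); first by rewrite before // ep hM.
  by move=> y hy; rewrite before //; have := runmin_le s hy; lia.
- move=> n s i j _ hi hj far /eqP hi1 /eqP hj1; apply/eqP.
  have lei x := @runmin_le _ s i x; have lej x := @runmin_le _ s j x.
  case: far => far; last first.
    have -> : coll i j = j by rewrite /coll; lia.
    have before x : x <= j.+1 -> entry (del s i) x = (entry s x).-1.
      move=> hx; have := lei x; rewrite delE //; last by lia.
      have -> : skip i x = x by rewrite /skip; lia.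
      by lia.
    have [p hp ep] := runmin_ex s j; have := lei j.+1.
    rewrite before // => h; apply: (runmin_eq hp).
      by rewrite before ?ep; lia.
    move=> y hy; rewrite before; last by lia.
    by have := lej y; lia.
  have cj : skip i (coll i j).+1 = j.+1 by rewrite /skip /coll; lia.
  have hlt : entry s j.+1 < entry s i.+1 by have := lej i.+1; lia.
  rewrite [entry _ (coll i j).+1]delE //; last by rewrite /coll; lia.
  rewrite cj; have -> : (entry s i.+1 < entry s j.+1) = false by lia.
  rewrite subn0.
  have lower y : y <= coll i j -> (entry s j.+1).+1 <= entry (del s i) y.
    move=> hy; rewrite delE //; last by move: hy; rewrite /coll; lia.
    by have := lej (skip i y); move: hy; rewrite /skip /coll; lia.
  have [p hp ep] := runmin_ex s j.
  (* If the deleted entry was the minimum up to [j], the minimum up to [i] takes over: it was larger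
     by one, and the deletion lowers it by one. *)
  case: (eqVneq p i.+1) => [pi|pi].
    have [q hq eq] := runmin_ex s i.
    apply: (@runmin_eq _ _ _ q) => //; first by rewrite /coll; lia.
    rewrite delE //; last by lia.
    have -> : skip i q = q by rewrite /skip; lia.
    by rewrite pi in ep; lia.
  apply: (@runmin_eq _ _ _ (coll i p)) => //; first by rewrite /coll; lia.
  rewrite delE //; last by rewrite /coll; lia.
  have -> : skip i (coll i p) = p by rewrite /skip /coll; lia.
  have := @entry_neq _ s p i.+1; lia.
Qed.

(** * Symmetries *)

Definition compl n (s : 'S_n) : 'S_n := mkperm n (fun x => n.-1 - entry s x).
Definition rever n (s : 'S_n) : 'S_n := mkperm n (fun x => entry s (n.-1 - x)).

Lemma complE n (s : 'S_n) x : x < n -> entry (compl s) x = n.-1 - entry s x.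
Proof.
move=> hx; rewrite /compl mkpermE // => {x hx} [x hx|x y hx hy].
  by have := entry_lt s hx; lia.
have := @entry_neq n s x y; have := entry_lt s hx; have := entry_lt s hy; lia.
Qed.

Lemma reverE n (s : 'S_n) x : x < n -> entry (rever s) x = entry s (n.-1 - x).
Proof.
move=> hx; rewrite /rever mkpermE // => {x hx} [x hx|x y hx hy].
  by apply: entry_lt; lia.
have := @entry_neq n s (n.-1 - x) (n.-1 - y); lia.
Qed.

Lemma complK n (s : 'S_n) : compl (compl s) = s.
Proof.
apply: entry_ext => x hx; rewrite !complE //.
by have := entry_lt s hx; lia.
Qed.

Lemma reverK n (s : 'S_n) : rever (rever s) = s.
Proof.
apply: entry_ext => x hx; rewrite !reverE //; last by lia.
by congr entry; lia.
Qed.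

Lemma compl_cmp n (s : 'S_n) x y : x < n -> y < n ->
  (entry (compl s) x < entry (compl s) y) = (entry s y < entry s x).
Proof.
move=> hx hy; rewrite !complE //.
have := entry_lt s hx; have := entry_lt s hy; lia.
Qed.

Lemma occ_compl m (tau : 'S_m) n (s : 'S_n) f :
  occ tau s 0 m f -> occ (compl tau) (compl s) 0 m f.
Proof.
case=> f0 f1 f2; split=> // j j' hj hj'.
by rewrite !compl_cmp ?f2 // f0.
Qed.

Lemma occ_rever m (tau : 'S_m) n (s : 'S_n) f :
  occ tau s 0 m f ->
  occ (rever tau) (rever s) 0 m (fun j => n.-1 - f (m.-1 - j)).
Proof.
case=> f0 f1 f2.
have g0 j : j < m -> f (m.-1 - j) < n by move=> hj; apply: f0; lia.
split=> [j hj|j j' _ h1 h2|j j' hj hj'].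
- by have := g0 j hj; lia.
- have := f1 (m.-1 - j') (m.-1 - j); have := g0 j; have := g0 j'; lia.
- rewrite !reverE //; last first.
    by have := g0 j; lia.
    by have := g0 j'; lia.
  have e k : k < m -> n.-1 - (n.-1 - f (m.-1 - k)) = f (m.-1 - k).
    by move=> hk; have := g0 k hk; lia.
  by rewrite !e // f2 //; lia.
Qed.

Lemma card_avoiders_compl m (tau : 'S_m) n :
  #|avoiders (compl tau) n| = #|avoiders tau n|.
Proof.
rewrite -(card_imset (mem (avoiders tau n)) (can_inj (@complK n))).
apply: eq_card => s; apply/avoidersP/imsetP.
  move=> h; exists (compl s); last by rewrite complK.
  apply/avoidersP => f /occ_compl; rewrite complK; exact: h.
move=> [t /avoidersP h ->] f /occ_compl; rewrite !complK; exact: h.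
Qed.

Lemma card_avoiders_rever m (tau : 'S_m) n :
  #|avoiders (rever tau) n| = #|avoiders tau n|.
Proof.
rewrite -(card_imset (mem (avoiders tau n)) (can_inj (@reverK n))).
apply: eq_card => s; apply/avoidersP/imsetP.
  move=> h; exists (rever s); last by rewrite reverK.
  apply/avoidersP => f /occ_rever; rewrite reverK; exact: h.
move=> [t /avoidersP h ->] f /occ_rever; rewrite !reverK; exact: h.
Qed.

Lemma slow_compl m (tau : 'S_m) : slow (compl tau) -> slow tau.
Proof. by move=> h n; have := h n; rewrite !(card_avoiders_compl tau). Qed.

Lemma slow_rever m (tau : 'S_m) : slow (rever tau) -> slow tau.
Proof. by move=> h n; have := h n; rewrite !(card_avoiders_rever tau). Qed.

Lemma twin_compl n (s : 'S_n) i b : twin (compl s) i b = twin s i (~~ b).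
Proof.
rewrite /twin; case: (ltnP i.+1 n) => //= hi; rewrite !complE //; last by lia.
have := entry_lt s hi; have := entry_lt s (ltnW hi).
by case: b => /=; lia.
Qed.

Lemma twin_rever n (s : 'S_n) i b : i.+1 < n ->
  twin (rever s) i b = twin s (n - i.+2) (~~ b).
Proof.
move=> hi; rewrite /twin hi !reverE //; last by lia.
have -> : n.-1 - i = (n - i.+2).+1 by lia.
have -> : n.-1 - i.+1 = n - i.+2 by lia.
by case: b => /=; lia.
Qed.

(** * Supermultiplicativity *)

Definition dsum p q (s : 'S_p) (t : 'S_q) : 'S_(p + q) :=
  mkperm (p + q) (fun x => if x < p then entry s x else p + entry t (x - p)).

Lemma dsumE p q (s : 'S_p) (t : 'S_q) x : x < p + q ->
  entry (dsum s t) x = if x < p then entry s x else p + entry t (x - p).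
Proof.
move=> hx; rewrite /dsum mkpermE // => {x hx} [x hx|x y hx hy].
  case: (ltnP x p) => c; first by have := entry_lt s c; lia.
  by have := @entry_lt q t (x - p); lia.
case: (ltnP x p) => c; case: (ltnP y p) => c'.
- exact: entry_inj.
- by have := entry_lt s c; lia.
- by have := entry_lt s c'; lia.
- by have := @entry_neq q t (x - p) (y - p); lia.
Qed.

(** If the last entry of [tau] is not above the first, no occurrence in a direct sum begins in the
    left summand and ends in the right one. Complementation reduces the general case to this. *)
Lemma avoiders_supermul m (tau : 'S_m) : 0 < m ->
  forall p q, #|avoiders tau p| * #|avoiders tau q| <= #|avoiders tau (p + q)|.
Proof.
move=> hm; wlog t0 : tau / entry tau m.-1 <= entry tau 0 => [wl p q|].
  case: (leqP (entry tau m.-1) (entry tau 0)) => [/wl //|c].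
  rewrite -!(card_avoiders_compl tau); apply: wl.
  rewrite !complE //; last by lia.
  have := @entry_lt m tau m.-1; have := entry_lt tau hm; lia.
move=> p q; rewrite -cardsX.
rewrite -(card_in_imset (f := fun st => dsum st.1 st.2)); last first.
  move=> [s t] [s' t'] _ _ /= e.
  congr pair; apply: entry_ext => x hx.
    have h : x < p + q by lia.
    by have := congr1 (fun s => entry s x) e; rewrite /= !dsumE // hx.
  have h : p + x < p + q by lia.
  have := congr1 (fun s => entry s (p + x)) e; rewrite /= !dsumE //.
  have -> : (p + x < p) = false by lia.
  have -> : p + x - p = x by lia.
  by move/addnI.
apply/subset_leq_card/fintype.subsetP => _ /imsetP [[s t] /setXP [hs ht] ->] /=.
apply/avoidersP => f fo; case: (fo) => f0 f1 f2.
have mono j j' : j <= j' -> j' < m -> f j <= f j'.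
  by rewrite leq_eqVlt => /orP [/eqP ->|h1 h2]; [|apply/ltnW/f1].
case: (ltnP (f m.-1) p) => c1.
  have h j : j < m -> f j < p by move=> hj; have := mono j m.-1; lia.
  move/avoidersP: hs => /(_ (id \o f)); apply.
  apply: (occ_map fo) => [j hj|j j' h1 h2 h3|j j' hj hj']; first exact: h.
    exact: f1.
  by rewrite !dsumE ?f0 // !h.
case: (ltnP (f 0) p) => c2; last first.
  have h j : j < m -> p <= f j by move=> hj; have := mono 0 j; lia.
  move/avoidersP: ht => /(_ (subn^~ p \o f)); apply.
  apply: (occ_map fo) => [j hj|j j' h1 h2 h3|j j' hj hj'] /=.
  - by have := f0 j hj; have := h j hj; lia.
  - by have := f1 j j'; have := h j; have := h j'; lia.
  - rewrite !dsumE ?f0 //.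
    by have := h j hj; have := h j' hj'; case: (ltnP (f j)); case: (ltnP (f j')); lia.
have := f2 0 m.-1; rewrite !dsumE ?f0 //; try by lia.
rewrite c2; have := entry_lt s c2; case: (ltnP (f m.-1)); lia.
Qed.

(** * Tight pairs at both ends: condition C3 *)

(* Here tau = h, h+1, X, h+3, h+2.  Doubling an entry p to 12 creates tau only
   if p starts a copy of h+1, X, h+3, h+2, doubling it to 21 only if p ends a
   copy of h, h+1, X, h+3; glueing two such copies at p produces tau, so at
   least one of the two doublings is allowed. *)
Section TightEnds.

Variables (m : nat) (tau : 'S_m) (h : nat).
Hypotheses (hm : 3 < m) (t0 : entry tau 0 = h) (t1 : entry tau 1 = h.+1).
Hypotheses (t2 : entry tau (m - 2) = h + 3) (t3 : entry tau (m - 1) = h + 2).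
Hypothesis only12 : forall k, twin tau k true -> k = 0.
Hypothesis only21 : forall k, twin tau k false -> k = m - 2.

Lemma middle k : 1 < k -> k < m - 2 -> entry tau k < h \/ h + 3 < entry tau k.
Proof.
move=> h1 h2; have ne := @entry_neq m tau k.
by have := ne 0; have := ne 1; have := ne (m - 2); have := ne (m - 1); lia.
Qed.

Definition starts n (s : 'S_n) i := exists2 g, occ tau s 1 m g & g 1 = i.
Definition ends n (s : 'S_n) i := exists2 g, occ tau s 0 (m - 1) g & g (m - 2) = i.

(** The occurrence created must use the two copies as the only tight 12 of [tau], in roles 0 and 1;
    dropping role 0 leaves the copy sought. *)
Lemma ins12_starts n (s : 'S_n) i : s \in avoiders tau n -> i < n ->
  ins s i (entry s i + true) \notin avoiders tau n.+1 -> starts s i.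
Proof.
move=> /avoidersP hs hi /avoidersP hc; apply: contrapT => hS; apply: hc => f fo.
apply: (hs (coll i \o f)); apply: (occ_ins hi fo) => k h1 h2 fk fk1.
have [c1 c2] := occ_ins_twin hi fo h1 h2 fk fk1.
have k0 : k = 0.
  by apply: only12; rewrite -c1; exact: twin_of_cmp.
rewrite k0 in fk fk1; apply: hS; exists (coll i \o f); last first.
  by rewrite /= fk1 /coll; lia.
apply: (occ_ins (b := true) hi); first exact: occ_sub fo.
by case: fo => _ f1 _ j j1 jm fj _; have := f1 0 j; lia.
Qed.

Lemma ins21_ends n (s : 'S_n) i : s \in avoiders tau n -> i < n ->
  ins s i (entry s i + false) \notin avoiders tau n.+1 -> ends s i.
Proof.
move=> /avoidersP hs hi /avoidersP hc; apply: contrapT => hS; apply: hc => f fo.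
apply: (hs (coll i \o f)); apply: (occ_ins hi fo) => k h1 h2 fk fk1.
have [c1 c2] := occ_ins_twin hi fo h1 h2 fk fk1.
have k0 : k = m - 2.
  by apply: only21; rewrite -c1; exact: twin_of_cmp.
rewrite k0 in fk fk1; apply: hS; exists (coll i \o f); last first.
  by rewrite /= fk /coll; lia.
apply: (occ_ins (b := false) hi); first by apply: occ_sub fo; lia.
by case: fo => _ f1 _ j j1 jm fj fj1; have := f1 j (m - 2); lia.
Qed.

Lemma starts_ins12 n (s : 'S_n) i : i < n -> starts s i ->
  ins s i (entry s i + true) \notin avoiders tau n.+1.
Proof.
move=> hi [g go g1]; apply/avoidersP.
move=> /(_ (fun k => if k == 0 then i else if k == 1 then i.+1 else (g k).+1)).
apply; case: (go) => f0 f1 f2.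
have late k : 1 < k -> k < m -> i < g k by move=> k1 km; rewrite -g1; apply: f1.
have hv : entry s i + true <= n by have := entry_lt s hi; lia.
have nth k : 1 < k -> k < m ->
    entry (ins s i (entry s i + true)) (g k).+1 =
    entry s (g k) + (entry s i < entry s (g k)).
  move=> k1 km; have := late k k1 km; have := f0 k; move=> a b.
  rewrite insE //; last by lia.
  have -> : coll i (g k).+1 = g k by rewrite /coll; lia.
  by case: ifP => [/eqP|_]; lia.
have nth0 : entry (ins s i (entry s i + true)) i = entry s i.
  rewrite insE //; last by lia.
  have -> : coll i i = i by rewrite /coll; lia.
  by case: ifP => [/eqP|_]; lia.
have cmp1 k : 1 < k -> k < m -> (entry s i < entry s (g k)) = (h.+1 < entry tau k).
  by move=> k1 km; rewrite -t1 -g1 f2; lia.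
apply: occ_lt => // [k hk|k k' _ kk' hk'].
  case: k hk => [|[|k]] hk /=; [lia|lia|].
  by have := f0 k.+2; lia.
case: k kk' => [|[|k]] kk'; case: k' kk' hk' => [|[|k']] kk' hk' //=.
- split=> //; rewrite nth0 ins_new // t0 t1; lia.
- split; first by have := late k'.+2; lia.
  rewrite nth0 nth // t0; have := cmp1 k'.+2.
  have := @entry_neq m tau 1 k'.+2.
  have := @entry_neq n s i (g k'.+2); have := f0 k'.+2; have := late k'.+2; lia.
- split; first by have := late k'.+2; lia.
  rewrite ins_new // nth // t1; have := cmp1 k'.+2.
  have := @entry_neq n s i (g k'.+2); have := f0 k'.+2; have := late k'.+2; lia.
- split; first by have := f1 k.+2 k'.+2; lia.
  rewrite !nth //; last by lia.
  rewrite -f2; [|lia|lia].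
  have := cmp1 k'.+2; have := cmp1 k.+2.
  have := @entry_neq n s (g k.+2) (g k'.+2).
  have := f0 k'.+2; have := f0 k.+2; have := f1 k.+2 k'.+2; lia.
Qed.

Section Gluing.

Variables (n : nat) (s : 'S_n) (p lo : nat) (g1 g2 : nat -> nat).
Hypotheses (hlo : lo <= 1) (o1 : occ tau s lo (m - 1) g1) (e1 : g1 (m - 2) = p).
Hypotheses (o2 : occ tau s 1 m g2) (e2 : g2 1 = p).

Let pe : g1 1 < p /\ entry s (g1 1) < entry s p.
Proof.
case: o1 => _ a b; rewrite -e1; split; first by apply: a; lia.
by rewrite b ?t1 ?t2; lia.
Qed.

Let hp : p < n.
Proof. by case: o2 => a _ _; rewrite -e2; apply: a; lia. Qed.

(** The entry at [g2 k0] lies to the right of [p], with value between those in the roles of h+1 and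
    h+3. As X has no values there, it can end the copy [g1] in the role of h+2. *)
Lemma glue_low k0 : 1 < k0 < m - 2 -> entry tau k0 < h ->
  entry s (g1 1) < entry s (g2 k0) ->
  occ tau s lo m (fun k => if k <= m - 2 then g1 k else g2 k0).
Proof.
move=> hk0 tk0 low; have [pe1 pe2] := pe.
case: o1 => a0 a1 a2; case: o2 => b0 b1 b2.
have x1 : p < g2 k0 by rewrite -e2; apply: b1; lia.
have x2 : entry s (g2 k0) < entry s p by rewrite -e2 b2 ?t1; lia.
apply: occ_lt => // [k hk|k k' hk kk' hk'].
  by case: (leqP k (m - 2)) => c; [apply: a0 | apply: b0]; lia.
have -> : k <= m - 2 by lia.
case: (leqP k' (m - 2)) => c; first by split; [apply: a1 | apply: a2]; lia.
have k'E : k' = m - 1 by lia.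
split.
  case: (ltngtP k (m - 2)) => d; [|lia|by rewrite d e1].
  by have := a1 k (m - 2); rewrite e1; lia.
rewrite k'E t3; case: (ltngtP k (m - 2)) => d; [|lia|rewrite d e1 t2; lia].
case: k hk kk' d => [|[|k]] hk kk' d.
- have : entry s (g1 0) < entry s (g1 1) by rewrite a2 ?t0 ?t1; lia.
  by rewrite t0; lia.
- by rewrite t1; lia.
- have u1 : (entry s (g1 1) < entry s (g1 k.+2)) = (h.+1 < entry tau k.+2).
    by rewrite a2 ?t1; lia.
  have u2 : (entry s p < entry s (g1 k.+2)) = (h + 3 < entry tau k.+2).
    by rewrite -e1 a2 ?t2; lia.
  have := @middle k.+2; have := @occ_inj m tau _ _ _ _ _ 1 k.+2 o1.
  have := @entry_neq n s (g1 1) (g1 k.+2); have := a0 1; have := a0 k.+2; lia.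
Qed.

(** The entry at [g1 1] lies below [p] and above all low entries of X in [g2]. It can precede [p] in
    the role of h ([a = 0]) or replace [p] in the role of h+1 ([a = 1]). *)
Lemma glue_high :
  (forall k, 1 < k < m - 2 -> entry tau k < h ->
    entry s (g2 k) < entry s (g1 1)) ->
  forall a, a <= 1 -> occ tau s a m (fun k => if k <= a then g1 1 else g2 k).
Proof.
move=> low a ha; have [pe1 pe2] := pe.
case: o2 => b0 b1 b2.
apply: occ_lt => // [k hk|k k' hk kk' hk'].
  by case: (leqP k a) => c; [have := hp; lia | apply: b0; lia].
have -> : (k' <= a) = false by lia.
have pk : p <= g2 k'.
  case: (ltngtP 1 k') => c; [|lia|by rewrite -c e2].
  by have := b1 1 k'; rewrite e2; lia.
case: (leqP k a) => c; last by split; [apply: b1 | apply: b2]; lia.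
have ka : k = a by lia.
split; first by lia.
have tk : entry tau k <= h.+1.
  have : a = 0 \/ a = 1 by lia.
  by rewrite ka => -[->|->]; rewrite ?t0 ?t1; lia.
have u : (entry s p < entry s (g2 k')) = (h.+1 < entry tau k').
  by rewrite -e2 b2 ?t1; lia.
case: (ltngtP 1 k') => c'; first last.
- have k0 : k = 0 by lia.
  by rewrite -c' e2 t1 k0 t0; lia.
- by lia.
case: (ltngtP k' (m - 2)) => c1.
- have tn : h <= entry tau k.
    have : a = 0 \/ a = 1 by lia.
    by rewrite ka => -[->|->]; rewrite ?t0 ?t1; lia.
  by have := low k'; have := @middle k' c' c1; lia.
- have k'E : k' = m - 1 by lia.
  by move: u; rewrite k'E t3; lia.
- by move: u; rewrite c1 t2; lia.
Qed.

Lemma glue_dichotomy :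
  (exists k, [/\ 1 < k < m - 2, entry tau k < h & entry s (g1 1) < entry s (g2 k)])
  \/ (forall k, 1 < k < m - 2 -> entry tau k < h ->
      entry s (g2 k) < entry s (g1 1)).
Proof.
case: (pselect (exists k, [/\ 1 < k < m - 2, entry tau k < h &
   entry s (g1 1) < entry s (g2 k)])) => [|no]; [by left|right=> k hk tk].
rewrite ltnNge; apply/negP => c; apply: no; exists k; split=> //.
have [pe1 _] := pe; case: o2 => b0 b1 _.
have := @entry_neq n s (g1 1) (g2 k); have := b0 k; have := b1 1 k.
by rewrite e2; lia.
Qed.

End Gluing.

Lemma starts_ends n (s : 'S_n) i : s \in avoiders tau n ->
  starts s i -> ends s i -> False.
Proof.
move=> /avoidersP hs [g2 o2 e2] [g1 o1 e1].
case: (glue_dichotomy (leq0n 1) o1 e1 o2 e2) => [[k [h1 h2 h3]]|low].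
  exact: (hs _ (glue_low (leq0n 1) o1 e1 o2 e2 h1 h2 h3)).
exact: (hs _ (glue_high (leq0n 1) o1 e1 o2 e2 low (leq0n 1))).
Qed.

(** This transfers a forbidden 12 from the end of a copy of h+1, X, h+3 to its beginning, as the
    deletion of a mark requires. *)
Lemma starts_glue n (s : 'S_n) i g1 : occ tau s 1 (m - 1) g1 ->
  g1 (m - 2) = i -> starts s i -> starts s (g1 1).
Proof.
move=> o1 e1 [g2 o2 e2].
case: (glue_dichotomy (leqnn 1) o1 e1 o2 e2) => [[k [h1 h2 h3]]|low].
  exists (fun k' => if k' <= m - 2 then g1 k' else g2 k).
    exact: (glue_low (leqnn 1) o1 e1 o2 e2 h1 h2 h3).
  by have -> : 1 <= m - 2 by lia.
by exists (fun k => if k <= 1 then g1 1 else g2 k) => //;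
  exact: (glue_high (leqnn 1) o1 e1 o2 e2 low).
Qed.

Let good12 n (s : 'S_n) i := ins s i (entry s i + true) \in avoiders tau n.+1.

(** A 12 needs no further condition: undoubling it gives a parent for which the 12 is allowed,
    namely with [s] itself as result. *)
Let mark n : 'S_n -> nat -> bool :=
  if n is n'.+1 then fun s i =>
    twin s i true || (twin s i false && ~~ good12 (del s i) i)
  else fun _ _ => false.

Lemma slow_tight_ends : slow tau.
Proof.
apply: (ratio_step (v := fun n s i => entry s i + good12 s i) (M := mark)).
- move=> n s i hs hi; have hv : entry s i + good12 s i <= n.
    by have := entry_lt s hi; lia.
  split=> //; last first.
    rewrite /mark del_ins //; case g : (good12 s i).
      by rewrite (ins_twin s true hi).
    by rewrite (ins_twin s false hi) orbT.
  case g : (good12 s i); first exact: g.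
  apply/negPn/negP => /(ins21_ends hs hi).
  by apply: (starts_ends hs); apply: ins12_starts; rewrite // -/(good12 s i) g.
- move=> n s i hs hi /orP [tw|/andP [tw /negbTE ->]]; last exact: twin_del_val.
  suff -> : good12 (del s i) i by exact: twin_del_val.
  by rewrite /good12 twin_ins_del.
- move=> n s i j hs hi hj far mi /orP [tw|/andP [tw bad]]; apply/orP.
    by left; apply: twin_del.
  right; apply/andP; split; first exact: twin_del.
  have hcij : coll i j < n by rewrite /coll; lia.
  have hcji : coll j i < n by rewrite /coll; lia.
  have ij : i != j by lia.
  set pi := del (del s i) (coll i j).
  have piE : pi = del (del s j) (coll j i) by rewrite /pi del_del.
  have avi : del s i \in avoiders tau n.+1 by exact: del_avoid.
  have avj : del s j \in avoiders tau n.+1 by exact: del_avoid.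
  have [b [twb sb]] : exists b, twin s i b /\ (~~ b -> starts (del s i) i).
    case/orP: mi => [|/andP [ti gi]]; first by exists true.
    by exists false; split=> // _; apply: ins12_starts.
  have [g go g1] : starts (del s j) j by exact: ins12_starts.
  have far' : j.+1 < i \/ i.+1 < j by lia.
  have twj := twin_del hj hi far' twb.
  have insj := twin_ins_del hcji twj; rewrite -piE in insj.
  have cc : coll (coll j i) j = coll i j by rewrite /coll; lia.
  apply: starts_ins12 => //.
  (* The copy [g] shows that the 12 is forbidden at [j] before the deletion at [i]. It survives the
     collapse of the pair at [i] unless it uses both entries of that pair. *)
  case: (pselect (exists k, [/\ 1 <= k, k.+1 < m, g k = coll j i
                              & g k.+1 = (coll j i).+1])) => [|no]; last first.
    exists (coll (coll j i) \o g); last by rewrite /= g1.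
    rewrite -insj in go; apply: (occ_ins hcji go) => k h1 h2 h3 h4.
    by apply: no; exists k.
  move=> [k [k1 km gk gk1]]; rewrite -insj in go.
  have [c1 c2] := occ_ins_twin hcji go k1 km gk gk1.
  have k2 : 1 < k.
    rewrite ltn_neqAle k1 andbT; apply/eqP => kk; move: gk; rewrite -kk g1.
    by rewrite /coll; lia.
  (* Role 0 is missing in [g], but its value h is adjacent to the value h+1 of role 1, so it
     separates no other two entries unless role 1 does. *)
  have twt : twin tau k b.
    rewrite -c1; apply: twin_of_cmp => // -[|y] hy n1 n2; last exact: c2.
    have := c2 1; have := @entry_neq m tau 1 k; have := @entry_neq m tau 1 k.+1.
    have := @entry_neq m tau 0 k; have := @entry_neq m tau 0 k.+1.
    by rewrite t0 t1; lia.
  case: b twb sb insj twj go c1 twt => twb sb insj twj go c1 twt.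
    by have := only12 twt; lia.
  (* So the pair at [i] is a 21 and ends the copy [g]. Without its last entry, [g] becomes a copy of
     h+1, X, h+3 that ends at the collapsed pair. *)
  have kE := only21 twt; rewrite kE in gk.
  have ji : j < i.
    have := gk; rewrite -g1; case: go => _ f1 _; have := f1 1 (m - 2).
    by rewrite /coll; lia.
  have cij : coll i j = j by rewrite /coll; lia.
  have cji : coll j i = i.-1 by rewrite /coll; lia.
  have o1 : occ tau pi 1 (m - 1) (coll (coll j i) \o g).
    apply: (@occ_ins m tau n pi (coll j i) false) => //.
      by apply: occ_sub go => //; lia.
    case: go => _ f1 _ k' h1 h2 h3 h4.
    by have := f1 k' (m - 2); have := f1 k'.+1 (m - 2); lia.
  have -> : coll i j = (coll (coll j i) \o g) 1 by rewrite /= g1 cc.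
  apply: (starts_glue o1 (i := coll j i)).
    by rewrite /= gk /coll; lia.
  (* As the pair at [i] is a marked 21, a copy starts there as well. It lies to the right of
     position [j], so it survives the collapse of the pair at [j]. *)
  have [g' go' g1'] := sb isT.
  have twi := twin_del hi hj far tw.
  have insi := twin_ins_del hcij twi; rewrite -/pi in insi.
  exists (coll (coll i j) \o g'); last by rewrite /= g1' cij.
  rewrite -insi in go'; apply: (occ_ins hcij go') => k' h1 h2 h3 h4.
  case: go' => _ f1 _; move: h3; rewrite cij.
  case: (ltngtP 1 k') => c; [|lia|by rewrite -c g1'; lia].
  by have := f1 1 k'; rewrite g1'; lia.
Qed.

End TightEnds.

(** * From the conditions C1, C2 and C3 to the ratio inequality *)

Lemma tight12_atE m (tau : 'S_m) p :
  tight12_at tau p <-> 0 < p /\ twin tau p.-1 true.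
Proof.
split=> [[i [j [<- ji tj]]]|[p0 /andP [hp /eqP h]]].
  have hj := ltn_ord j; split=> //; rewrite /twin /= -ji hj !entry_ord /=; lia.
have hp' : p.-1 < m by lia.
exists (Ordinal hp'), (Ordinal hp); split=> //=; first by lia.
by rewrite -!entry_ord /=; lia.
Qed.

Lemma tight21_atE m (tau : 'S_m) p :
  tight21_at tau p <-> 0 < p /\ twin tau p.-1 false.
Proof.
split=> [[i [j [<- ji tj]]]|[p0 /andP [hp /eqP h]]].
  have hj := ltn_ord j; split=> //; rewrite /twin /= -ji hj !entry_ord /=; lia.
have hp' : p.-1 < m by lia.
exists (Ordinal hp'), (Ordinal hp); split=> //=; first by lia.
by rewrite -!entry_ord /=; lia.
Qed.

Lemma no_tight12 m (tau : 'S_m) : ~ tight12 tau -> forall k, ~~ twin tau k true.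
Proof. by move=> no k; apply/negP => h; apply: no; exists k.+1; apply/tight12_atE. Qed.

Lemma no_tight21 m (tau : 'S_m) : ~ tight21 tau -> forall k, ~~ twin tau k false.
Proof. by move=> no k; apply/negP => h; apply: no; exists k.+1; apply/tight21_atE. Qed.

Lemma condC1_slow m (tau : 'S_m) : condC1 tau -> slow tau.
Proof.
case=> [/no_tight12|/no_tight21] h; first exact: slow_no_tight12.
by apply/slow_compl/slow_no_tight12 => k; rewrite twin_compl.
Qed.

(** Reversal brings the extremal entry to the front, and complementation makes it minimal. *)
Lemma condC2_slow m (tau : 'S_m) : 1 < m -> condC2 tau -> slow tau.
Proof.
move=> hm [i [hi ht]].
wlog i0 : tau i hi ht / i = 0 :> nat => [wl|].
  have [e|ne] := eqVneq (i : nat) 0; first exact: (wl tau i).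
  have m0 : 0 < m by lia.
  apply: slow_rever; apply: (wl _ (Ordinal m0)) => //=; first by left.
  rewrite -entry_ord reverE // (_ : m.-1 - _ = i) ?entry_ord //=.
  by case: hi; lia.
rewrite -!entry_ord i0 in ht; case: ht => ht.
  by apply: slow_first_min => //; lia.
apply: slow_compl; apply: slow_first_min => //; rewrite complE; lia.
Qed.

(** With h the first and e the last entry, the bounds and distinctness leave e = h + 2 or h = e + 2.
    Reversal exchanges the two cases: it swaps both the ends and the kinds of tight pairs. *)
Lemma slow_window m (tau : 'S_m) : 3 < m ->
  (forall k, twin tau k true <-> k = 0) ->
  (forall k, twin tau k false <-> k = m - 2) ->
  entry tau 1 < entry tau (m - 1) + 4 -> entry tau (m - 2) < entry tau 0 + 4 ->
  slow tau.
Proof.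
move=> hm h12 h21 w1 w2.
have /andP [_ /eqP e1] := (h12 0).2 erefl.
have /andP [_ /eqP e2] := (h21 (m - 2)).2 erefl.
rewrite (_ : (m - 2).+1 = m - 1) in e2; last by lia.
have n1 := @entry_neq m tau 0 (m - 1); have n2 := @entry_neq m tau 1 (m - 1).
have n3 := @entry_neq m tau 0 (m - 2).
case: (ltnP (entry tau 0) (entry tau (m - 1))) => c.
  apply: (@slow_tight_ends m tau (entry tau 0)) => //; try lia.
    by move=> k /h12.
  by move=> k /h21.
apply: slow_rever; apply: (@slow_tight_ends _ _ (entry tau (m - 1))) => //.
- by rewrite reverE; [congr entry|]; lia.
- rewrite reverE; last by lia.
  have -> : m.-1 - 1 = m - 2 by lia.
  by lia.
- rewrite reverE; last by lia.
  have -> : m.-1 - (m - 2) = 1 by lia.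
  by lia.
- rewrite reverE; last by lia.
  have -> : m.-1 - (m - 1) = 0 by lia.
  by lia.
- move=> k tk; have hk : k.+1 < m by case/andP: tk.
  by move: tk; rewrite twin_rever // => /h21; lia.
- move=> k tk; have hk : k.+1 < m by case/andP: tk.
  by move: tk; rewrite twin_rever // => /h12; lia.
Qed.

Lemma condC3_slow m (tau : 'S_m) : condC3 tau -> slow tau.
Proof.
case=> hm [h hset] ht.
have window j : j < m -> j.+1 \in [:: 1; 2; m - 1; m] ->
    h <= (entry tau j).+1 < h + 4.
  move=> hj jin; rewrite (entryE tau hj).
  suff : tau (Ordinal hj) \in [set v : 'I_m | h <= v.+1 < h + 4] by rewrite inE.
  by rewrite -hset; apply: imset_f; rewrite inE.
have w0 := window 0 ltac:(lia) ltac:(by rewrite !inE; lia).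
have w1 := window 1 ltac:(lia) ltac:(by rewrite !inE; lia).
have w2 := window (m - 2) ltac:(lia) ltac:(by rewrite !inE; lia).
have w3 := window (m - 1) ltac:(lia) ltac:(by rewrite !inE; lia).
have ends12 q (t : 'S_m) : (forall p, tight12_at t p <-> p = q.+1) ->
    forall k, twin t k true <-> k = q.
  move=> H k; split=> [tk|->].
    by have /H [] : tight12_at t k.+1 by apply/tight12_atE.
  by have /tight12_atE [_] := (H q.+1).2 erefl.
have ends21 q (t : 'S_m) : (forall p, tight21_at t p <-> p = q.+1) ->
    forall k, twin t k false <-> k = q.
  move=> H k; split=> [tk|->].
    by have /H [] : tight21_at t k.+1 by apply/tight21_atE.
  by have /tight21_atE [_] := (H q.+1).2 erefl.
have m1 : m - 1 = (m - 2).+1 by lia.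
case: ht => -[]; rewrite m1.
  move=> /ends12 h12 /ends21 h21; apply: slow_window => //; lia.
move=> /ends21 h21 /ends12 h12; apply: slow_compl; apply: slow_window.
- by lia.
- by move=> k; rewrite twin_compl.
- by move=> k; rewrite twin_compl.
- by rewrite !complE; lia.
- by rewrite !complE; lia.
Qed.

(** * Inflation of an entry to a block *)

(* Replaces the entry at position a by a copy of t on consecutive positions and
   consecutive values. *)
Definition infl n l a n' (s : 'S_n') (t : 'S_l) : 'S_n :=
  mkperm n (fun x => if (a <= x) && (x < a + l) then entry s a + entry t (x - a)
    else let v := entry s (if x < a then x else x - l.-1) in
         if v < entry s a then v else v + l.-1).

Section Inflation.

Variables (n n' l a : nat) (s : 'S_n') (t : 'S_l).
Hypotheses (hn : n.+1 = n' + l) (hl : 0 < l) (ha : a < n').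

Let u := infl n a s t.
(** [squash] contracts the block to position [a]; [stretch] is the section of it that picks the
    first position of the block. *)
Let squash x := if x < a then x else if x < a + l then a else x - l.-1.
Let stretch x := if x <= a then x else x + l.-1.

Lemma squash_lt x : x < n -> squash x < n'.
Proof. by rewrite /squash; case: (ltnP x a) => ?; [|case: (ltnP x (a + l)) => ?]; lia. Qed.

Lemma squash_out x : x < n -> ~~ (a <= x < a + l) -> squash x <> a.
Proof. by rewrite /squash; case: (ltnP x a) => ?; [|case: (ltnP x (a + l)) => ?]; lia. Qed.

Lemma squash_in x : a <= x < a + l -> squash x = a.
Proof. by rewrite /squash; case: (ltnP x a) => ?; [|case: (ltnP x (a + l)) => ?]; lia. Qed.

Lemma squash_stretch x : squash (stretch x) = x.
Proof.
rewrite /squash /stretch; case: (leqP x a) => ?.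
  by case: (ltnP x a); case: (ltnP x (a + l)); lia.
by case: (ltnP (x + l.-1) a); case: (ltnP (x + l.-1) (a + l)); lia.
Qed.

Lemma stretch_lt x : x < n' -> stretch x < n.
Proof. by rewrite /stretch; case: (leqP x a); lia. Qed.

Lemma squash_mono x y : x < y -> squash x < squash y \/ a <= x < a + l /\ a <= y < a + l.
Proof.
move=> xy; rewrite /squash.
by case: (ltnP x a) => ?; [|case: (ltnP x (a + l)) => ?];
  (case: (ltnP y a) => ?; [|case: (ltnP y (a + l)) => ?]); lia.
Qed.

Lemma infl_val x : x < n -> entry u x =
  if (a <= x) && (x < a + l) then entry s a + entry t (x - a)
  else if entry s (squash x) < entry s a then entry s (squash x)
       else entry s (squash x) + l.-1.
Proof.
have sqE x' : ~~ (a <= x' < a + l) ->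
    squash x' = if x' < a then x' else x' - l.-1.
  by rewrite /squash; case: (ltnP x' a) => ?; [|case: (ltnP x' (a + l)) => ?]; lia.
have sa := entry_lt s ha.
move=> hx; rewrite /u /infl mkpermE //; [|move=> {x hx} x hx|move=> {x hx} x y hx hy].
- by case: ifP => // /negbT /sqE ->.
- case: ifP => [h|/negbT h].
    by have := @entry_lt l t (x - a); lia.
  rewrite -sqE //; have := entry_lt s (squash_lt hx).
  have := @entry_neq n' s (squash x) a (squash_lt hx) ha (squash_out hx h).
  by cbv zeta; case: ifP; lia.
- case: (boolP ((a <= x) && (x < a + l))) => h;
    case: (boolP ((a <= y) && (y < a + l))) => h'.
  + move/addnI => e; have := @entry_inj l t (x - a) (y - a); lia.
  + rewrite -(sqE y) //; have := @entry_lt l t (x - a).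
    have := @entry_neq n' s (squash y) a (squash_lt hy) ha (squash_out hy h').
    by cbv zeta; case: ifP; lia.
  + rewrite -(sqE x) //; have := @entry_lt l t (y - a).
    have := @entry_neq n' s (squash x) a (squash_lt hx) ha (squash_out hx h).
    by cbv zeta; case: ifP; lia.
  + have e2 := @entry_neq n' s (squash x) (squash y) (squash_lt hx) (squash_lt hy).
    have e3 := @squash_mono x y; have e4 := @squash_mono y x.
    rewrite -(sqE x) // -(sqE y) //; cbv zeta.
    by case: ifP => ?; case: ifP => ?; lia.
Qed.

Lemma infl_block x : x < l -> entry u (a + x) = entry s a + entry t x.
Proof.
move=> hx; rewrite infl_val; last by lia.
have -> : (a <= a + x) && (a + x < a + l) by lia.
by congr (_ + entry t _); lia.
Qed.

Lemma infl_cmp_in x y : a <= x < a + l -> a <= y < a + l ->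
  (entry u x < entry u y) = (entry t (x - a) < entry t (y - a)).
Proof.
move=> hx hy; rewrite -[x in LHS](@subnKC a) -1?[y in LHS](@subnKC a); try lia.
by rewrite !infl_block; lia.
Qed.

Lemma infl_cmp_out x y : x < n -> y < n -> ~~ (a <= x < a + l) || ~~ (a <= y < a + l) ->
  (entry u x < entry u y) = (entry s (squash x) < entry s (squash y)).
Proof.
move=> hx hy out; rewrite !infl_val //.
have sx := @entry_neq n' s (squash x) a (squash_lt hx) ha.
have sy := @entry_neq n' s (squash y) a (squash_lt hy) ha.
have ox := squash_out hx; have oy := squash_out hy.
have ix := @squash_in x; have iy := @squash_in y.
case: (boolP ((a <= x) && (x < a + l))) out => bx out;
  case: (boolP ((a <= y) && (y < a + l))) out => dy out //.
- rewrite (ix bx); have := @entry_lt l t (x - a).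
  by case: ifP; have := sy (oy dy); lia.
- rewrite (iy dy); have := @entry_lt l t (y - a).
  by case: ifP; have := sx (ox bx); lia.
- by case: ifP; case: ifP; have := sx (ox bx); have := sy (oy dy); lia.
Qed.

Lemma infl_clusters : u \in clusters n l (entry s a).+1.
Proof.
have an : a < n by lia.
have sa := entry_lt s ha.
rewrite inE; apply/existsP; exists (Ordinal an); apply/andP; split; first by rewrite /=; lia.
apply/eqP/setP => v; rewrite inE; apply/imsetP/idP => [[i]|hv].
  rewrite inE /= => hi ->; rewrite -entry_ord.
  have := infl_block (x := i - a); have := @entry_lt l t (i - a).
  by rewrite subnKC; lia.
have [x hx ex] := @entry_surj l t (v - entry s a) ltac:(lia).
have hax : a + x < n by lia.
exists (Ordinal hax); first by rewrite inE /=; lia.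
by apply: val_inj; rewrite /= -entry_ord /= infl_block // ex; lia.
Qed.

Variables (m : nat) (tau : 'S_m).

Lemma infl_avoid_base : u \in avoiders tau n -> s \in avoiders tau n'.
Proof.
move=> /avoidersP hu; apply/avoidersP => f fo; case: (fo) => f0 f1 f2.
apply: (hu (stretch \o f)); apply: (occ_map fo) => [j hj|j j' h1 h2 h3|j j' hj hj'].
- by apply/stretch_lt/f0.
- by have := f1 j j' h1 h2 h3; rewrite /stretch; case: (leqP (f j) a); case: (leqP (f j') a); lia.
- case: (eqVneq (f j) (f j')) => [->|ne]; first by rewrite !ltnn.
  rewrite infl_cmp_out ?squash_stretch ?stretch_lt ?f0 //.
  by rewrite /stretch; case: (leqP (f j) a); case: (leqP (f j') a); lia.
Qed.

Lemma infl_avoid_block : u \in avoiders tau n -> t \in avoiders tau l.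
Proof.
move=> /avoidersP hu; apply/avoidersP => f fo; case: (fo) => f0 f1 f2.
apply: (hu (addn a \o f)); apply: (occ_map fo) => [j hj|j j' h1 h2 h3|j j' hj hj'].
- by have := f0 j hj; lia.
- by have := f1 j j' h1 h2 h3; lia.
- by rewrite !infl_block ?f0 // ltn_add2l.
Qed.

(** With at most one entry in the block, the occurrence would squash to one in [s]. Two roles in the
    block force all roles between them into it. *)
Lemma infl_occ_pair f : s \in avoiders tau n' -> occ tau u 0 m f ->
  exists j, [/\ j.+1 < m, a <= f j < a + l & a <= f j.+1 < a + l].
Proof.
move=> /avoidersP hs fo; case: (fo) => f0 f1 f2; apply: contrapT => no.
have far j j' : j < j' -> j' < m -> a <= f j < a + l -> a <= f j' < a + l -> False.
  move=> jj' hj' b b'; apply: no; exists j; split=> //; first by lia.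
  have := f1 j j.+1; case: (ltngtP j.+1 j') => c; [|lia|by rewrite c].
  by have := f1 j.+1 j'; lia.
apply: (hs (squash \o f)); apply: (occ_map fo) => [j hj|j j' h1 h2 h3|j j' hj hj'].
- by apply/squash_lt/f0.
- have [|[b b']] := squash_mono (f1 j j' h1 h2 h3); first by [].
  by case: (far j j').
- case: (eqVneq j j') => [->|ne]; first by rewrite !ltnn.
  rewrite infl_cmp_out ?f0 //; apply/negPn; rewrite negb_or !negbK; apply/negP => /andP [b b'].
  by case: (ltngtP j j') => c; [apply: (far j j')|apply: (far j' j)|lia].
Qed.

(** Two consecutive roles in the block are separated neither by an entry outside it nor, by
    monotonicity, by an entry inside it. They would form a tight pair of [tau] of kind [b]. *)
Lemma infl_mono_avoid b : s \in avoiders tau n' ->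
  (forall x y, x < y -> y < l -> (entry t x < entry t y) = b) ->
  (forall k, ~~ twin tau k b) -> u \in avoiders tau n.
Proof.
move=> hs mono nt; apply/avoidersP => f fo.
have [j [hj b1 b2]] := infl_occ_pair hs fo; case: (fo) => f0 f1 f2.
have jj := f1 j j.+1 isT (ltnSn j) hj.
have tb : (entry tau j < entry tau j.+1) = b.
  by rewrite -f2; [rewrite infl_cmp_in // mono|..]; lia.
have /negP := nt j; apply; rewrite -tb; apply: twin_of_cmp => // y hy n1 n2.
rewrite -!f2; try lia.
case: (boolP (a <= f y < a + l)) => b3; last first.
  by rewrite !infl_cmp_out ?f0 ?b3 ?orbT // ?(squash_in b1) ?(squash_in b2); lia.
have inv x z : x < z -> z < l -> (entry t z < entry t x) = ~~ b.
  move=> h1 h2; have := mono x z h1 h2; have := @entry_neq l t x z; lia.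
rewrite !infl_cmp_in //; case: (ltnP y j) => c.
  have g1 := f1 y j isT c (ltnW hj); have g2 := f1 y j.+1 isT (leqW c) hj.
  by rewrite !inv //; lia.
have c1 : j < y by lia.
have c2 : j.+1 < y by lia.
have g1 := f1 j y isT c1 hy; have g2 := f1 j.+1 y isT c2 hy.
by rewrite !mono //; lia.
Qed.

End Inflation.

(** The two blocks occupy the same values, hence the same positions, so [a = a']; the rest is read
    off entry by entry. *)
Lemma infl_inj n n' l a a' (s s' : 'S_n') (t t' : 'S_l) :
  n.+1 = n' + l -> 0 < l -> a < n' -> a' < n' -> entry s a = entry s' a' ->
  infl n a s t = infl n a' s' t' -> s = s' /\ t = t'.
Proof.
move=> hn hl ha ha' es e.
have e' x : entry (infl n a s t) x = entry (infl n a' s' t') x by rewrite e.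
have aa : a = a'.
  suff half b b' (v v' : 'S_n') (w w' : 'S_l) : b < n' -> b' < n' ->
     entry v b = entry v' b' ->
     infl n b v w = infl n b' v' w' -> b' <= b.
    by apply/eqP; rewrite eqn_leq (half a a' s s' t t') // (half a' a s' s t' t).
  move=> hb hb' ev E; rewrite leqNgt; apply/negP => c.
  have hbn : b < n by lia.
  have : entry (infl n b v w) (b + 0) = entry (infl n b' v' w') b.
    by rewrite addn0 E.
  rewrite infl_block // infl_val //.
  have -> : (b' <= b) && (b < b' + l) = false by lia.
  rewrite c; have := entry_lt w hl; have := @entry_neq n' v' b b'.
  by case: ifP; lia.
subst a'; split; last first.
  apply: entry_ext => x hx; have := e' (a + x).
  by rewrite !infl_block // es => /addnI.
apply: entry_ext => x hx.
have [->|ne] := eqVneq x a; first exact: es.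
pose y := if x <= a then x else x + l.-1.
have hy : y < n by rewrite /y; case: (leqP x a); lia.
have := e' y; rewrite !infl_val //.
have -> : (a <= y) && (y < a + l) = false by rewrite /y; case: (leqP x a); lia.
have -> : (if y < a then y else if y < a + l then a else y - l.-1) = x.
  rewrite /y; case: (leqP x a) => c.
    by case: (ltnP x a); case: (ltnP x (a + l)); lia.
  by case: (ltnP (x + l.-1) a); case: (ltnP (x + l.-1) (a + l)); lia.
have := @entry_neq n' s x a; have := @entry_neq n' s' x a.
by case: ifP; case: ifP; lia.
Qed.

(** * Counting clusters *)

Lemma clusters_infl n n' l k (u : 'S_n) : n.+1 = n' + l -> 0 < l ->
  0 < k <= n' -> u \in clusters n l k ->
  exists a (s : 'S_n') (t : 'S_l),
    [/\ a < n', (entry s a).+1 = k & u = infl n a s t].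
Proof.
move=> hn hl hk; rewrite inE => /existsP [[a an] /= /andP [al /eqP/setP hset]].
have block x : x < n -> (a <= x < a + l) = (k <= (entry u x).+1 < k + l).
  move=> hx; have := hset (u (Ordinal hx)); rewrite inE (entryE u hx) => <-.
  apply/idP/imsetP => [h|[i]]; first by exists (Ordinal hx); rewrite ?inE.
  by rewrite inE => hi /perm_inj e; move: hi; rewrite -e.
have ha : a < n' by lia.
pose stretch x := if x <= a then x else x + l.-1.
have out x : x < n' -> x <> a -> stretch x < n /\ ~~ (k <= (entry u (stretch x)).+1 < k + l).
  move=> hx xa; have h : stretch x < n by rewrite /stretch; case: (leqP x a); lia.
  by rewrite -block // h; split=> //; rewrite /stretch; case: (leqP x a); lia.
(* Contraction: the block becomes the single value [k.-1], and the values above it drop by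
   [l.-1]. *)
pose w x := if x == a then k.-1 else
  if entry u (stretch x) < k.-1 then entry u (stretch x)
  else entry u (stretch x) - l.-1.
have sE x : x < n' -> entry (mkperm n' w) x = w x.
  apply: mkpermE => {}x; rewrite /w.
    move=> hx; case: eqP => [_|xa]; first by lia.
    have [h1 h2] := out x hx xa; have := entry_lt u h1.
    by case: (ltnP (entry u (stretch x)) k.-1); lia.
  move=> y hx hy; case: eqP => [->|xa]; case: eqP => [->|ya] //.
  - have [h1 h2] := out y hy ya.
    by case: (ltnP (entry u (stretch y)) k.-1); lia.
  - have [h1 h2] := out x hx xa.
    by case: (ltnP (entry u (stretch x)) k.-1); lia.
  - have [h1 h2] := out x hx xa; have [h3 h4] := out y hy ya => e.
    have {}e : entry u (stretch x) = entry u (stretch y).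
      by move: e; case: (ltnP (entry u (stretch x)) k.-1);
        case: (ltnP (entry u (stretch y)) k.-1); lia.
    move: (entry_inj h1 h3 e); rewrite /stretch.
    by case: (leqP x a); case: (leqP y a); lia.
have tE x : x < l -> entry (mkperm l (fun x => entry u (a + x) - k.-1)) x =
    entry u (a + x) - k.-1.
  apply: mkpermE => {}x.
    by move=> hx; have := block (a + x); lia.
  move=> y hx hy; have := block (a + x); have := block (a + y).
  by have := @entry_inj n u (a + x) (a + y); lia.
exists a, (mkperm n' w), (mkperm l (fun x => entry u (a + x) - k.-1)).
have wa : w a = k.-1 by rewrite /w eqxx.
split=> //; first by rewrite sE // wa; lia.
apply: entry_ext => x hx; rewrite infl_val // !sE // ?wa; last first.
  by case: (ltnP x a) => ?; [|case: (ltnP x (a + l))]; lia.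
case: (boolP ((a <= x) && (x < a + l))) => hb.
  rewrite tE; last by lia.
  have -> : a + (x - a) = x by lia.
  by have := block x hx; lia.
set y := if x < a then _ else _.
have hy : y < n' by rewrite /y; case: (ltnP x a) => ?; [|case: (ltnP x (a + l))]; lia.
have ya : y <> a by rewrite /y; case: (ltnP x a) => ?; [|case: (ltnP x (a + l))]; lia.
have sy : stretch y = x.
  rewrite /y /stretch; case: (ltnP x a) => c.
    by case: (leqP x a); lia.
  case: (ltnP x (a + l)) => c'; first by lia.
  by case: (leqP (x - l.-1) a); lia.
rewrite /w; case: eqP => // _; rewrite sy.
have := block x hx.
case: (ltnP (entry u x) k.-1) => c; first by rewrite c.
by case: (ltnP (entry u x - l.-1) k.-1) => c'; lia.
Qed.

Section ClusterCount.

Variables (m : nat) (tau : 'S_m) (n n' l k : nat).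
Hypotheses (hn : n.+1 = n' + l) (hl : 0 < l) (hk : 0 < k <= n').

(** The block must occupy the values from [k] on, so the entry to inflate is the one of 1-based
    value [k]. *)
Let F (st : 'S_n' * 'S_l) : 'S_n := infl n (entry (st.1^-1)%g k.-1) st.1 st.2.

Let F_at a (s : 'S_n') : a < n' -> (entry s a).+1 = k -> entry (s^-1)%g k.-1 = a.
Proof.
move=> ha <-; rewrite /= [entry s a]entryE entry_ord.
by rewrite permK.
Qed.

Let F_pos (s : 'S_n') : entry (s^-1)%g k.-1 < n' /\
  entry s (entry (s^-1)%g k.-1) = k.-1.
Proof.
have hk' : k.-1 < n' by lia.
rewrite (entryE _ hk'); split=> //.
by rewrite entry_ord permKV.
Qed.

Lemma card_clusters_le :
  #|clusters n l k :&: avoiders tau n| <= #|avoiders tau n'| * #|avoiders tau l|.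
Proof.
rewrite -cardsX; apply: leq_trans (leq_imset_card F _).
apply/subset_leq_card/fintype.subsetP => u; rewrite finset.in_setI => /andP [hc hu].
have [a [s [t [ha sa uE]]]] := clusters_infl hn hl hk hc.
apply/imsetP; exists (s, t); last by rewrite /F /= (F_at ha sa).
rewrite uE in hu; rewrite finset.in_setX /=.
by rewrite (infl_avoid_base hn hl ha hu) (infl_avoid_block hn hl ha hu).
Qed.

Lemma card_clusters_ge (T : {set 'S_l}) :
  (forall a (s : 'S_n') t, a < n' -> s \in avoiders tau n' -> t \in T ->
    infl n a s t \in avoiders tau n) ->
  #|avoiders tau n'| * #|T| <= #|clusters n l k :&: avoiders tau n|.
Proof.
move=> hT; rewrite -cardsX -(card_in_imset (f := F)); last first.
  move=> [s t] [s' t'] _ _; rewrite /F /=.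
  have [h1 h2] := F_pos s; have [h3 h4] := F_pos s'.
  by move=> /(infl_inj hn hl h1 h3) [|-> ->] //; rewrite h2 h4.
apply/subset_leq_card/fintype.subsetP => _ /imsetP [[s t] /setXP [hs ht] ->].
have [h1 h2] := F_pos s; rewrite /F finset.in_setI hT // andbT.
have := @infl_clusters n n' l _ s t hn hl h1; rewrite h2 prednK //; lia.
Qed.

End ClusterCount.

(** * Cluster-free patterns *)

(** All entries of the block have the same set [D] of smaller entries outside it, so their values
    lie in the [l] consecutive values from [#|D|] on and fill them. *)
Lemma interval_cluster m (tau : 'S_m) b l : b + l <= m -> 0 < l ->
  (forall x x' y, b <= x < b + l -> b <= x' < b + l -> y < m ->
     ~~ (b <= y < b + l) ->
     (entry tau y < entry tau x) = (entry tau y < entry tau x')) ->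
  exists k, [/\ 1 <= k, k + l - 1 <= m & tau \in clusters m l k].
Proof.
move=> hb hl hc; have hbm : b < m by lia.
pose B := [set i : 'I_m | b <= i < b + l].
have cB : #|B| = l.
  have -> : B = [set i : 'I_m | i < b + l] :\: [set i : 'I_m | i < b].
    by apply/setP => i; rewrite !inE; lia.
  rewrite cardsDS; last by apply/fintype.subsetP => i; rewrite !inE; lia.
  by rewrite !card_ltn_ord; lia.
pose D := [set j in ~: B | tau j < tau (Ordinal hbm)].
have cD : #|D| + l <= m.
  rewrite -[X in _ <= X]card_ord -(cardsC B) cB addnC leq_add2l.
  by apply/subset_leq_card/fintype.subsetP => j; rewrite inE => /andP [].
have bound (i : 'I_m) : i \in B -> #|D| <= tau i < #|D| + l.
  move=> iB; rewrite -card_below.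
  have -> : [set j | tau j < tau i] = D :|: [set j in B | tau j < tau i].
    apply/setP => j; rewrite !inE; case: (boolP (b <= j < b + l)) => //= jB.
    rewrite orbF -!entry_ord; apply: hc => //=; first by rewrite inE in iB.
    by lia.
  rewrite cardsU (_ : D :&: _ = finset.set0) ?cards0 ?subn0; last first.
    by apply/setP => j; rewrite !inE; case: (b <= j < b + l) => //=; rewrite andbF.
  rewrite leq_addr ltn_add2l -cB; apply: proper_card; apply/properP; split.
    by apply/fintype.subsetP => j; rewrite inE => /andP [].
  by exists i; rewrite // inE ltnn andbF.
exists #|D|.+1; split=> //; first by lia.
rewrite inE; apply/existsP; exists (Ordinal hbm); rewrite /= hb /=.
rewrite eqEcard; apply/andP; split.
  apply/fintype.subsetP => _ /imsetP [i iB ->]; rewrite inE.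
  have iB' : i \in B by move: iB; rewrite !inE.
  by have := bound i iB'; rewrite ltnS addSn ltnS.
rewrite card_imset ?cB; last exact: perm_inj.
have -> : [set v : 'I_m | #|D| < v.+1 < #|D|.+1 + l] =
    [set v : 'I_m | v < #|D| + l] :\: [set v : 'I_m | v < #|D|].
  by apply/setP => i; rewrite !inE; lia.
rewrite cardsDS; last by apply/fintype.subsetP => i; rewrite !inE; lia.
by rewrite !card_ltn_ord; lia.
Qed.

(** The roles that an occurrence plays in the block are consecutive, at least two, and not separated
    by the other roles. They form a cluster of [tau], unless they are all of [tau], which would then
    occur in [t]. *)
Lemma infl_cluster_free m (tau : 'S_m) n n' l a (s : 'S_n') (t : 'S_l) :
  cluster_free tau -> n.+1 = n' + l -> 0 < l -> a < n' ->
  s \in avoiders tau n' -> t \in avoiders tau l ->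
  infl n a s t \in avoiders tau n.
Proof.
move=> cf hn hl ha hs ht; apply/avoidersP => f fo.
have [j [hj b1 b2]] := infl_occ_pair hn hl ha hs fo; case: (fo) => f0 f1 f2.
have mono x y : x <= y -> y < m -> f x <= f y.
  by rewrite leq_eqVlt => /orP [/eqP ->|h1 h2]; [|apply/ltnW/f1].
pose P x := (x < m) && (a <= f x < a + l).
have Pj : P j by rewrite /P; lia.
have exP : exists x, P x by exists j.
have ubP x : P x -> x <= m by rewrite /P; lia.
case: (ex_minnP exP) => b Pb minb; case: (ex_maxnP exP ubP) => e Pe maxe.
have be : b < e by have := minb j Pj; have := maxe j.+1; rewrite /P; lia.
have inside x : x < m -> (b <= x < b + (e - b).+1) = (a <= f x < a + l).
  move=> hx; apply/idP/idP => h; last first.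
    by have := minb x; have := maxe x; rewrite /P hx h => /(_ isT) ? /(_ isT) ?; lia.
  move: Pb Pe; rewrite /P => /andP [_ Pb] /andP [em Pe].
  by have := mono b x; have := mono x e; lia.
have em : e < m by move: Pe; rewrite /P; lia.
have hbe : b + (e - b).+1 <= m by lia.
have [|k [k1 k2 kc]] := @interval_cluster m tau b _ hbe isT.
  move=> x x' y hx hx' hy hny; have [xm x'm] : x < m /\ x' < m by lia.
  rewrite -!f2 //; rewrite inside // in hx; rewrite inside // in hx'.
  rewrite inside // in hny.
  rewrite !(infl_cmp_out s t hn hl ha) ?f0 ?hny //.
  by rewrite (squash_in hn hl ha hx) (squash_in hn hl ha hx').
case: (ltnP (e - b).+1 m) => c.
  have h2 : 2 <= (e - b).+1 <= m - 1 by lia.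
  by have := cf _ _ h2 k1 k2; rewrite kc.
have all x : x < m -> a <= f x < a + l by move=> hx; rewrite -inside //; lia.
move/avoidersP: ht => /(_ (subn^~ a \o f)); apply.
apply: (occ_map fo) => [x hx|x x' h1 h2 h3|x x' hx hx'] /=.
- by have := all x hx; lia.
- by have := f1 x x'; have := all x; have := all x'; lia.
- by rewrite (infl_cmp_in s t hn hl ha) ?all.
Qed.

(** For [m > 2] a tight 12 is a cluster of length 2, so C1 holds; for [m = 2] every entry is
    extremal and C2 applies. *)
Lemma cluster_free_slow m (tau : 'S_m) : 1 < m -> cluster_free tau -> slow tau.
Proof.
move=> hm cf; case: (ltnP 2 m) => hm2; last first.
  apply: condC2_slow => //; have m0 : 0 < m by lia.
  exists (Ordinal m0); split; first by left.
  by have := ltn_ord (tau (Ordinal m0)); lia.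
apply: slow_no_tight12 => i; apply/negP => /andP [hi tw].
have hi2 : i + 2 <= m by lia.
have [|k [k1 k2 kc]] := @interval_cluster m tau i 2 hi2 isT.
  move=> x x' y hx hx' hy hny.
  have := @entry_neq m tau i y; have := @entry_neq m tau i.+1 y.
  have [->|->] : x = i \/ x = i.+1 by lia.
    by have [->|->] : x' = i \/ x' = i.+1; lia.
  by have [->|->] : x' = i \/ x' = i.+1; lia.
have h2 : 2 <= 2 <= m - 1 by lia.
by have := cf _ _ h2 k1 k2; rewrite kc.
Qed.

(** * Avoiders of length at most m *)

Lemma occ_ge_id m (tau : 'S_m) n (s : 'S_n) f j : occ tau s 0 m f ->
  j < m -> j <= f j.
Proof.
case=> _ f1 _; elim: j => // j ih hj.
by have := f1 j j.+1; have := ih (ltnW hj); lia.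
Qed.

Lemma card_avoiders_small m (tau : 'S_m) n : n < m -> #|avoiders tau n| = n`!.
Proof.
move=> hn; rewrite -card_Sn; apply: eq_card => s; rewrite [RHS]inE.
apply/avoidersP => f fo; have hm : m.-1 < m by lia.
by have := occ_ge_id fo hm; case: fo => f0 _ _; have := f0 m.-1; lia.
Qed.

Lemma card_avoiders_self m (tau : 'S_m) : #|avoiders tau m|.+1 = m`!.
Proof.
have -> : avoiders tau m = ~: [set tau].
  apply/setP => s; rewrite finset.in_setC finset.in_set1; apply/avoidersP/idP.
    by move=> h; apply/eqP => e; apply: (h id); rewrite e; split=> // j /andP [].
  move=> /eqP ne f fo; apply: ne; case: (fo) => f0 f1 f2.
  have fid j : j < m -> f j = j.
    move=> hj; apply/eqP; rewrite eqn_leq (occ_ge_id fo hj) andbT.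
    (* The [m - j] increasing positions from [f j] on must fit below [m], so [f j <= j]. *)
    have up i : i < m - j -> f j + i <= f (j + i).
      elim: i => [|i ih] hi; first by rewrite !addn0.
      have h : i < m - j by lia.
      by have := ih h; have := f1 (j + i) (j + i).+1; rewrite !addnS; lia.
    by have := up (m - j).-1; have := f0 (j + (m - j).-1); lia.
  apply: entry_cmp_ext => x y hx hy.
  by rewrite -f2 // !fid.
by rewrite -card_Sn -(cardsC [set tau]) cards1 add1n.
Qed.

Local Open Scope classical_set_scope.
Local Open Scope ring_scope.

(** * The ratio limit *)

Lemma bernoulli_ineq (R : realFieldType) (x : R) n :
  -1 <= x -> 1 + x *+ n <= (1 + x) ^+ n.
Proof.
move=> hx; elim: n => [|n ih]; first by rewrite mulr0n addr0 expr0.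
rewrite exprS mulrS; have h : 0 <= 1 + x by lra.
apply: le_trans (ler_wpM2l h ih).
rewrite -!(mulr_natr x); have : 0 <= x * x * n%:R.
  by rewrite -expr2 mulr_ge0 ?sqr_ge0.
by lra.
Qed.

Lemma expr_unbounded (R : realType) (x y : R) : 1 < x ->
  exists Q, forall q, (Q <= q)%N -> y <= x ^+ q.
Proof.
move=> x1; exists (Num.bound `|y / (x - 1)|) => q hq.
have x10 : 0 < x - 1 by lra.
have -> : x = 1 + (x - 1) by ring.
apply: le_trans (bernoulli_ineq q _); last by lra.
have h1 : y / (x - 1) < q%:R.
  apply: le_lt_trans (ler_norm _) _.
  by apply: lt_le_trans (archi_boundP (normr_ge0 _)) _; rewrite ler_nat.
rewrite ltr_pdivrMr // in h1; rewrite -mulr_natl; lra.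
Qed.

Section RatioLimit.

Variables (R : realType) (a : nat -> nat).
Hypotheses (a_gt0 : forall n, (0 < a n)%N)
  (a_super : forall p q, (a p * a q <= a (p + q))%N)
  (a_slow : forall n,
     (n.+1 * a n.+1 ^ 2 <= a n.+2 * (n * a n + 3 * a n.+1))%N).

Let b n : R := (a n)%:R.
Let rho n : R := b n / b n.+1.

Let b_gt0 n : 0 < b n. Proof. by rewrite ltr0n. Qed.

Let b_super p q : b p * b q <= b (p + q)%N.
Proof. by rewrite /b -natrM ler_nat. Qed.

Let b_ge1 n : 1 <= b n. Proof. by rewrite ler1n. Qed.

Let rho_gt0 n : 0 < rho n. Proof. by rewrite divr_gt0. Qed.

Let drift n j : (n + j)%:R * rho (n + j)%N <= n%:R * rho n + (3 * j)%:R.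
Proof.
elim: j => [|j ih]; first by rewrite addn0 muln0 addr0.
have step i : i.+1%:R * rho i.+1 <= i%:R * rho i + 3.
  rewrite /rho; have h : i.+1%:R * b i.+1 ^+ 2 <= b i.+2 * (i%:R * b i + 3 * b i.+1).
    by rewrite /b -natrX -!natrM -natrD -natrM ler_nat a_slow.
  rewrite mulrA ler_pdivrMr // -(ler_pM2r (b_gt0 i.+1)).
  have -> : (i%:R * (b i / b i.+1) + 3) * b i.+2 * b i.+1 =
      b i.+2 * (i%:R * b i + 3 * b i.+1).
    by field; exact: lt0r_neq0 (b_gt0 i.+1).
  by rewrite -mulrA -expr2.
rewrite addnS; apply: le_trans (step _) _.
by rewrite mulnS natrD; lra.
Qed.

(** The infimum of [K] is that of b_n^(-1/n) over n > 0, written without roots; it is 0 for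
    superexponential growth. *)
Let K : set R := [set c | 0 <= c /\ exists2 n, (0 < n)%N & 1 <= b n * c ^+ n].
Let kappa := inf K.

Let K1 : K 1.
Proof. by split; [exact: ler01|exists 1%N => //; rewrite expr1 mulr1; exact: b_ge1]. Qed.

Let kappa_ge0 : 0 <= kappa.
Proof. by apply: lb_le_inf; [exists 1 | move=> x []]. Qed.

Let lbK : has_lbound K.
Proof. by exists 0 => x []. Qed.

Let below n (c : R) : (0 < n)%N -> 0 <= c -> c < kappa -> b n * c ^+ n < 1.
Proof.
move=> n0 c0 ck; rewrite ltNge; apply/negP => h.
suff : kappa <= c by lra.
by apply: ge_inf => //; split=> //; exists n.
Qed.

Let at_kappa n : (0 < n)%N -> b n * kappa ^+ n <= 1.
Proof.
move=> n0; rewrite leNgt; apply/negP => h.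
have k0 : 0 < kappa.
  rewrite lt_neqAle kappa_ge0 andbT; apply/eqP => k0; move: h.
  by rewrite -k0 expr0n (gtn_eqF n0) /= mulr0; lra.
(* Bernoulli: c = kappa (1 - d) still satisfies b n * c ^+ n >= 1. *)
pose z := b n * kappa ^+ n; have z0 : 0 < z by rewrite /z mulr_gt0 ?exprn_gt0.
pose d := (1 - z^-1) / n%:R.
have n0' : 0 < n%:R :> R by rewrite ltr0n.
have zi1 : z^-1 < 1 by rewrite invf_lt1.
have zi0 : 0 < z^-1 by rewrite invr_gt0.
have d0 : 0 < d by rewrite divr_gt0 //; lra.
have d1 : d <= 1 - z^-1.
  rewrite /d ler_pdivrMr //; rewrite ler_peMr //; first by lra.
  by rewrite ler1n.
have ck : kappa * (1 - d) < kappa by rewrite gtr_pMr //; lra.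
have c0 : 0 <= kappa * (1 - d) by rewrite mulr_ge0 //; lra.
have := below n0 c0 ck; rewrite exprMn mulrA -/z.
have : 1 + (- d) *+ n <= (1 - d) ^+ n by apply: bernoulli_ineq; lra.
rewrite -mulr_natr /d mulNr divfK ?gt_eqF // => hb hlt.
have : z * z^-1 <= z * (1 - d) ^+ n by rewrite ler_pM2l //; lra.
by rewrite divff ?gt_eqF //; lra.
Qed.

Let b_pow p q : b p ^+ q <= b (p * q)%N.
Proof.
elim: q => [|q ih]; first by rewrite expr0.
rewrite exprS mulnS; apply: le_trans (b_super _ _).
by rewrite ler_pM2l.
Qed.

(** The argument of Fekete: some p has b_p c^p > 1, and for n = pq + r supermultiplicativity gives
    b_n >= b_p^q. For c < 1 the remainder costs at most the factor c^p, which large q outweighs. *)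
Let above (c : R) : kappa < c -> exists N, forall n, (N <= n)%N -> 1 <= b n * c ^+ n.
Proof.
move=> kc; have [d [d0 [p p0 hp]] dc] := inf_lt (ex_intro _ 1 K1) kc.
have c0 : 0 < c by lra.
case: (leP 1 c) => c1.
  by exists 0%N => n _; rewrite -[1]mulr1 ler_pM ?exprn_ege1.
have hx : 1 < b p * c ^+ p.
  by apply: le_lt_trans hp _; rewrite ltr_pM2l // ltrXn2r // -lt0n.
have [Q hQ] := expr_unbounded (c ^- p) hx.
exists (Q * p)%N => n hn; set q := (n %/ p)%N.
have qQ : (Q <= q)%N by rewrite leq_divRL.
have h1 : b p ^+ q <= b n.
  have := b_super (p * q)%N (n - p * q)%N.
  rewrite subnKC; last by rewrite mulnC leq_divM.
  by apply: le_trans; apply: le_trans (b_pow _ _) _; rewrite ler_peMr // ltW.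
have h2 : c ^+ (p * q.+1) <= c ^+ n.
  apply: ler_wiXn2l; [exact: ltW|exact: ltW|].
  by rewrite mulnC ltnW // ltn_ceil.
apply: le_trans (ler_pM _ _ h1 h2); rewrite ?exprn_ge0 // ?(ltW c0) ?(ltW (b_gt0 _)) //.
rewrite mulnS exprD mulrCA exprM -exprMn.
have cp : c ^+ p != 0 by rewrite gt_eqF ?exprn_gt0.
by rewrite -[leLHS](divff cp) ler_pM2l ?exprn_gt0 // hQ.
Qed.

(** If r_n is too large, the drift bound keeps the [J] preceding ratios above c = kappa + e/2. Then
    b_(n-J) > b_n c^J >= b_(n-J) b_J c^J, although b_J c^J >= 1. A window of fixed length
    suffices. *)
Let rho_le (e : R) : 0 < e -> exists N, forall n, (N <= n)%N -> rho n <= kappa + e.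
Proof.
move=> e0; have [|N hN] := above (c := kappa + e / 2); first by lra.
(* The total drift 3J over the window must stay below (n - j) e/2, whence the factor 6. *)
pose J := N.+1; pose q := (Num.bound (6 * J%:R / e)).+1.
have q0 : 0 < q%:R :> R by rewrite ltr0n.
have hq : 6 * J%:R / e < q%:R.
  apply: lt_trans (archi_boundP _) _; last by rewrite ltr_nat.
  by rewrite divr_ge0 // ?mulr_ge0 // ltW.
exists (q + J)%N => n hn; rewrite leNgt; apply/negP => hr.
pose c := kappa + e / 2.
have c0 : 0 < c by rewrite /c ltr_wpDl //; lra.
have big j : (j <= J)%N -> c < rho (n - j)%N.
  move=> hj; have := drift (n - j) j; rewrite subnK; last by lia.
  have hM : q%:R <= (n - j)%:R :> R by rewrite ler_nat; lia.
  have M0 : 0 < (n - j)%:R :> R by apply: lt_le_trans hM.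
  have hjJ : (3 * j)%:R <= 3 * J%:R :> R by rewrite -natrM ler_nat; lia.
  have hJ : 6 * J%:R < (n - j)%:R * e.
    by rewrite -ltr_pdivrMr //; apply: lt_le_trans hM.
  have hnM : (n - j)%:R <= n%:R :> R by rewrite ler_nat leq_subr.
  have : (n - j)%:R * rho n <= n%:R * rho n by rewrite ler_pM2r.
  have : (n - j)%:R * (kappa + e) < (n - j)%:R * rho n by rewrite ltr_pM2l.
  rewrite -(ltr_pM2l M0 c) /c; nra.
have tele j : (j < J)%N -> b n * c ^+ j.+1 < b (n - j.+1)%N.
  have step i : (i < J)%N -> c * b (n - i)%N < b (n - i.+1)%N.
    move=> hi; have := big i.+1 hi.
    rewrite /rho (_ : (n - i.+1).+1 = (n - i)%N); last by lia.
    by rewrite ltr_pdivlMr.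
  elim: j => [|j ih] hj; first by have := step 0%N hj; rewrite subn0 expr1 mulrC.
  apply: lt_trans (step _ hj); rewrite exprS mulrCA.
  by rewrite ltr_pM2l // ih // ltnW.
have := tele N (ltnSn N); have := hN J (leqnSn N); rewrite -/c => h1 h2.
have hs := b_super (n - J) J; rewrite subnK in hs; last by lia.
have hc : 0 < c ^+ J by rewrite exprn_gt0.
have h3 : b (n - J)%N * (b J * c ^+ J) <= b n * c ^+ J.
  by rewrite mulrA ler_pM2r.
have h4 : b (n - J)%N <= b (n - J)%N * (b J * c ^+ J) by rewrite ler_peMr // ltW.
by have := le_lt_trans (le_trans h4 h3) h2; rewrite ltxx.
Qed.

(** If r_n is too small, the ratios stay below y = kappa - e/2 over the next j indices, with j about
    e n/6 at most, so b_n kappa^n <= (y/kappa)^j. The window is proportional to n because b_n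
    kappa^n is known only not to decay exponentially, so the contradiction needs an exponential
    gain. *)
Let rho_ge (e : R) : 0 < e -> exists N, forall n, (N <= n)%N -> kappa - e <= rho n.
Proof.
move=> e0; case: (leP kappa e) => ke.
  by exists 0%N => n _; have := rho_gt0 n; lra.
have k0 : 0 < kappa by apply: lt_trans ke.
pose y := kappa - e / 2; have y0 : 0 < y by rewrite /y; lra.
pose x := kappa / y; have x1 : 1 < x by rewrite /x ltr_pdivlMr // /y; lra.
have xi0 : 0 < x^-1 by rewrite invr_gt0; lra.
have xi1 : x^-1 < 1 by rewrite invf_lt1 //; lra.
pose q := (Num.bound (6 / e)).+1.
have q0 : 0 < q%:R :> R by rewrite ltr0n.
have hq : 6 < q%:R * e.
  rewrite -ltr_pdivrMr //; apply: lt_trans (archi_boundP _) _.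
    by rewrite divr_ge0 // ltW.
  by rewrite ltr_nat.
have qpos : (0 < q)%N by [].
(* By Bernoulli (1 - d)^(2q) >= 1 - 2qd = (1 + 1/x)/2 > 1/x, which is [hz]. *)
clearbody q; pose d := (1 - x^-1) / (4 * q%:R).
have q1 : 1 <= q%:R :> R by rewrite ler1n.
have d0 : 0 < d by rewrite divr_gt0 // ?mulr_gt0 //; lra.
have dq : d * (4 * q%:R) = 1 - x^-1 by rewrite /d divfK // gt_eqF // mulr_gt0.
have d1 : d < 1 by nra.
pose c := kappa / (1 - d).
have kE : kappa = c * (1 - d) by rewrite /c divfK // gt_eqF //; lra.
have kc : kappa < c by rewrite /c ltr_pdivlMr; nra.
have c0 : 0 < c by lra.
have [N hN] := above kc.
have hz : 1 < (1 - d) ^+ (2 * q) * x.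
  rewrite -ltr_pdivrMr; last by lra.
  rewrite div1r; apply: (@lt_le_trans _ _ (1 + (- d) *+ (2 * q))).
    by rewrite -mulr_natr natrM; nra.
  by apply: bernoulli_ineq; lra.
exists (maxn N q) => n; rewrite geq_max => /andP [nN nq].
rewrite leNgt; apply/negP => hr.
pose j := (n %/ q)%N; have j0 : (0 < j)%N by rewrite divn_gt0.
have jq : (j * q <= n)%N by rewrite leq_divM.
have n00 : (0 < n)%N by exact: leq_trans nq.
have jceil : (n <= 2 * q * j)%N.
  apply: leq_trans (ltnW (ltn_ceil n qpos)) _; rewrite -/j mulnAC.
  by rewrite leq_pmul2r // mul2n -addnn -addn1 leq_add2l.
clearbody j.
have small i : (i <= j)%N -> rho (n + i)%N < y.
  move=> hi; have h := drift n i.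
  have h1 : (3 * i)%:R <= 3 * j%:R :> R by rewrite natrM ler_pM2l ?ler_nat.
  have h2 : j%:R * q%:R <= n%:R :> R by rewrite -natrM ler_nat.
  have n0 : 0 < n%:R :> R by rewrite ltr0n.
  have jj : 0 < j%:R :> R by rewrite ltr0n.
  have h3 : n%:R * rho n < n%:R * (kappa - e) by rewrite ltr_pM2l.
  have h4 : j%:R * 6 <= j%:R * (q%:R * e) by rewrite ler_pM2l // ltW.
  have h5 : j%:R * q%:R * e <= n%:R * e by rewrite ler_pM2r.
  have h6 : n%:R * y <= (n + i)%:R * y by rewrite ler_pM2r // ler_nat leq_addr.
  have ni0 : 0 < (n + i)%:R :> R by rewrite ltr0n addn_gt0 n00.
  rewrite -(ltr_pM2l ni0); apply: lt_le_trans h6; rewrite /y.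
  lra.
have tele i : (i <= j)%N -> b n <= y ^+ i * b (n + i)%N.
  elim: i => [|i ih] hi; first by rewrite expr0 mul1r addn0.
  apply: le_trans (ih (ltnW hi)) _; rewrite exprSr -mulrA ler_pM2l ?exprn_gt0 //.
  by have := small i (ltnW hi); rewrite /rho addnS ltr_pdivrMr // => /ltW.
have h1 := tele j (leqnn j).
have h2 : b (n + j)%N * kappa ^+ (n + j) <= 1 by rewrite at_kappa // addn_gt0 n00.
have h3 := hN n nN.
have h4 : b n * kappa ^+ n * x ^+ j <= 1.
  rewrite /x expr_div_n mulrA ler_pdivrMr ?exprn_gt0 // mul1r -mulrA -exprD.
  have kn : 0 < kappa ^+ (n + j) by rewrite exprn_gt0.
  rewrite -(ler_pM2r kn) in h1; apply: le_trans h1 _.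
  by rewrite -mulrA ger_pMr // exprn_gt0.
have h5 : (1 - d) ^+ n * x ^+ j <= 1.
  apply: le_trans h4; have -> : kappa ^+ n = c ^+ n * (1 - d) ^+ n.
    by rewrite -exprMn -kE.
  rewrite mulrA -mulrA ler_peMl // ltW // mulr_gt0 // exprn_gt0 //; lra.
have h6 : (1 - d) ^+ (2 * q * j) <= (1 - d) ^+ n.
  by apply: ler_wiXn2l => //; lra.
have h7 : ((1 - d) ^+ (2 * q) * x) ^+ j <= 1.
  rewrite exprMn -exprM; apply: le_trans h5.
  by rewrite ler_pM2r // exprn_gt0 //; lra.
by have := exprn_egt1 j hz; rewrite -lt0n j0 ltNge h7.
Qed.

Let rho_cvg : rho n @[n --> \oo] --> kappa.
Proof.
apply/cvgrPdist_le => e e0.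
have [N1 h1] := rho_le e0; have [N2 h2] := rho_ge e0.
exists (maxn N1 N2) => // n /=; rewrite geq_max => /andP [n1 n2].
by rewrite distrC ler_distl; have := h1 n n1; have := h2 n n2; lra.
Qed.

Let u (n : nat) : R := b n `^ n%:R^-1.

Let u_gt0 n : 0 < u n. Proof. exact: powR_gt0. Qed.

Let u_exp n : (0 < n)%N -> u n ^+ n = b n.
Proof.
move=> n0; rewrite -powR_mulrn; last exact: ltW.
by rewrite -powRrM mulVf ?pnatr_eq0 -?lt0n // powRr1 // ltW.
Qed.

Let uinv_cvg : (u n)^-1 @[n --> \oo] --> kappa.
Proof.
apply/cvgrPdist_le => e e0.
have [|N hN] := above (c := kappa + e); first by lra.
exists N.+1 => // n /= nN; have n0 : (0 < n)%N by lia.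
have lo : kappa <= (u n)^-1.
  rewrite -(@ler_pXn2r _ n) ?nnegrE ?invr_ge0 // ?(ltW (u_gt0 n)) //.
  by rewrite exprVn u_exp // -[leRHS]mul1r ler_pdivlMr // mulrC at_kappa.
have hi : (u n)^-1 <= kappa + e.
  rewrite -(@ler_pXn2r _ n) ?nnegrE ?invr_ge0 // ?(ltW (u_gt0 n)) //; last first.
    by rewrite addr_ge0 // ltW.
  rewrite exprVn u_exp // -[leLHS]mul1r ler_pdivrMr // mulrC.
  by apply: hN; lia.
by rewrite distrC ler_distl; lra.
Qed.

(* If the growth is superexponential, then kappa = 0 and the root sequence has
   no limit in R; limn returns the junk value 0 = 0^-1, so the identity below
   needs no finiteness of the limit. *)
Let limn_root : (limn u)^-1 = kappa.
Proof.
have [k0|k0] := eqVneq kappa 0.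
  have dv : ~ cvgn u.
    move=> /cvg_ex [l ul]; have := cvgM uinv_cvg ul.
    rewrite k0 mul0r => h0.
    have h1 : (fun n => (u n)^-1 * u n) @ \oo --> (1 : R).
      rewrite (_ : (fun n => _) = fun=> 1); first exact: cvg_cst.
      by apply/funext => n; rewrite mulVf // gt_eqF.
    have : 0 = 1 :> R by apply: norm_cvg_unique h1; exact: h0.
    by move/eqP; rewrite eq_sym oner_eq0.
  by rewrite (dvgP dv) k0 -[RHS]invr0.
have : u n @[n --> \oo] --> kappa^-1.
  rewrite (_ : u = fun n => (u n)^-1^-1); first exact: cvgV.
  by apply/funext => n; rewrite invrK.
by move/cvg_lim => ->; rewrite ?invrK.
Qed.

Lemma ratio_iter_cvg j :
  ((a n)%:R / (a (n + j)%N)%:R : R) @[n --> \oo] -->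
    (limn (fun n : nat => ((a n)%:R : R) `^ n%:R^-1)) ^- j.
Proof.
rewrite -exprVn limn_root; elim: j => [|j ih].
  rewrite expr0; rewrite (_ : (fun n => _) = fun=> 1); first exact: cvg_cst.
  by apply/funext => n; rewrite addn0 divff // gt_eqF // ltr0n.
have h : rho (n + j)%N @[n --> \oo] --> kappa by have := rho_cvg; rewrite -(cvg_shiftn j).
rewrite exprSr (_ : (fun n => _) = fun n =>
  ((a n)%:R / (a (n + j)%N)%:R) * rho (n + j)%N); first exact: cvgM.
apply/funext => n; rewrite /rho addnS mulrA divfK // gt_eqF //.
exact: b_gt0.
Qed.

End RatioLimit.

(** * Limits superior and inferior, and the proportions of clusters *)

(** The bounds on [P] make the suprema of the tails genuine and their sequence convergent. *)
Lemma limn_sup_le (R : realType) (P v : nat -> R) (V : R) :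
  (forall n, 0 <= P n <= 1) -> (\forall n \near \oo, P n <= v n) ->
  v n @[n --> \oo] --> V -> limn_sup P <= V.
Proof.
move=> P01 [N1 _ hN1] vV.
have ub : has_ubound (range P) by exists 1 => _ [n _ <-]; case/andP: (P01 n).
have lb : has_lbound (range P) by exists 0 => _ [n _ <-]; case/andP: (P01 n).
apply/ler_addgt0Pr => e e0; apply: limr_le.
  by apply/cvg_ex; eexists; apply: cvg_sups_inf.
move/cvgrPdist_le: (vV) => /(_ e e0) [N2 _ hN2].
exists (maxn N1 N2) => // n /=; rewrite geq_max => /andP [n1 n2].
apply: ge_sup; first by exists (P n), n => /=.
move=> _ /= [p np <-]; apply: le_trans (hN1 p (leq_trans n1 np)) _.
by have := hN2 p (leq_trans n2 np); rewrite /= distrC ler_distl; lra.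
Qed.

Lemma limn_inf_ge (R : realType) (P v : nat -> R) (V : R) :
  (forall n, 0 <= P n <= 1) -> (\forall n \near \oo, v n <= P n) ->
  v n @[n --> \oo] --> V -> V <= limn_inf P.
Proof.
move=> P01 [N1 _ hN1] vV.
have ub : has_ubound (range P) by exists 1 => _ [n _ <-]; case/andP: (P01 n).
have lb : has_lbound (range P) by exists 0 => _ [n _ <-]; case/andP: (P01 n).
apply/ler_addgt0Pr => e e0; rewrite -lerBlDr; apply: limr_ge.
  by apply/cvg_ex; eexists; apply: cvg_infs_sup.
move/cvgrPdist_le: (vV) => /(_ e e0) [N2 _ hN2].
exists (maxn N1 N2) => // n /=; rewrite geq_max => /andP [n1 n2].
apply: lb_le_inf; first by exists (P n), n => /=.
move=> _ /= [p np <-]; apply: le_trans (hN1 p (leq_trans n1 np)).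
by have := hN2 p (leq_trans n2 np); rewrite /= distrC ler_distl; lra.
Qed.

Lemma card_avoiders_gt0 m (tau : 'S_m) n : (1 < m)%N -> (0 < #|avoiders tau n|)%N.
Proof.
move=> hm; elim: n => [|n ih]; first by rewrite card_avoiders_small //; lia.
have m0 : (0 < m)%N by lia.
apply: leq_trans (avoiders_supermul tau m0 1 n).
by rewrite muln_gt0 ih andbT card_avoiders_small.
Qed.

Lemma slow_ratio_cvg (R : realType) m (tau : 'S_m) j : (1 < m)%N -> slow tau ->
  (#|avoiders tau (n - j)|%:R / #|avoiders tau n|%:R : R) @[n --> \oo] -->
    (stanley_wilf R tau) ^- j.
Proof.
move=> hm sl; have m0 : (0 < m)%N by lia.
rewrite -(cvg_shiftn j).
have := @ratio_iter_cvg R _ (fun n => card_avoiders_gt0 tau n hm)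
  (avoiders_supermul tau m0) sl j.
by apply: cvg_trans; apply: near_eq_cvg; apply: nearW => n; rewrite /= addnK.
Qed.

Section Proportions.

Variables (R : realType) (m : nat) (tau : 'S_m) (l : nat) (k : nat -> nat).
Hypotheses (hm : (1 < m)%N) (hl : (2 <= l)%N).
Hypothesis hk : forall n : nat, (l <= n)%N -> (1 <= k n <= n - l + 1)%N.

Local Notation P n := (Pav R tau (clusters n l (k n))).
Local Notation q n :=
  (#|avoiders tau (n - (l - 1))|%:R / #|avoiders tau n|%:R : R).

Lemma Pav01 n (A : {set 'S_n}) : 0 <= Pav R tau A <= 1.
Proof.
have a0 : 0 < #|avoiders tau n|%:R :> R by rewrite ltr0n card_avoiders_gt0.
rewrite /Pav divr_ge0 ?ler0n //= ler_pdivrMr // mul1r ler_nat.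
by apply/subset_leq_card/fintype.subsetP => s; rewrite finset.in_setI => /andP [].
Qed.

Let sizes n : (l <= n)%N -> n.+1 = (n - (l - 1) + l)%N /\ (0 < k n <= n - (l - 1))%N.
Proof. by move=> ln; have := hk ln; lia. Qed.

Lemma Pav_le : \forall n \near \oo, P n <= #|avoiders tau l|%:R * q n.
Proof.
exists l => // n /= ln; have [s1 s2] := sizes ln; have l0 : (0 < l)%N by lia.
rewrite /Pav mulrA ler_pM2r ?invr_gt0 ?ltr0n ?card_avoiders_gt0 //.
by rewrite -natrM ler_nat mulnC card_clusters_le.
Qed.

(** [T] is a set of blocks that may replace any entry: all of S_l(tau) in (ii), one or both monotone
    blocks in (iii). *)
Lemma Pav_ge (T : {set 'S_l}%type) :
  (forall n n' a (s : 'S_n') t, n.+1 = (n' + l)%N -> (a < n')%N ->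
    s \in avoiders tau n' -> t \in T -> infl n a s t \in avoiders tau n) ->
  \forall n \near \oo, #|T|%:R * q n <= P n.
Proof.
move=> hT; exists l => // n /= ln; have [s1 s2] := sizes ln.
have l0 : (0 < l)%N by lia.
rewrite /Pav mulrA ler_pM2r ?invr_gt0 ?ltr0n ?card_avoiders_gt0 //.
rewrite -natrM ler_nat mulnC card_clusters_ge // => a s t.
exact: hT.
Qed.

End Proportions.

Local Close Scope classical_set_scope.

Theorem corollary1 (R : realType) (m : nat) (hm : (2 <= m)%N) (tau : 'S_m)
    (l : nat) (hl : (2 <= l)%N) (k : nat -> nat)
    (hk : forall n : nat, (l <= n)%N -> (1 <= k n <= n - l + 1)%N) :
  let L : R := stanley_wilf R tau in
  let P : nat -> R := fun n => Pav R tau (clusters n l (k n)) in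
  [/\ (* (i) *)
      condC1 tau \/ condC2 tau \/ condC3 tau ->
        limn_sup P <= #|avoiders tau l|%:R / L ^+ (l - 1),
      (* (ii) *)
      cluster_free tau ->
        [/\ (P n @[n --> \oo] --> (#|avoiders tau l|%:R / L ^+ (l - 1) : R))%classic,
            (l < m)%N ->
              (P n @[n --> \oo] --> (l`!%:R / L ^+ (l - 1) : R))%classic
          & l = m ->
              (P n @[n --> \oo] --> ((m`!%:R - 1) / L ^+ (m - 1) : R))%classic]
    & (* (iii) *)
      (~ tight12 tau \/ ~ tight21 tau ->
        1 / L ^+ (l - 1) <= limn_inf P) /\
      (~ tight12 tau /\ ~ tight21 tau ->
        2 / L ^+ (l - 1) <= limn_inf P)].
Proof.
move=> L P.
have l0 : (0 < l)%N by lia.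
have P01 n : 0 <= P n <= 1 by exact: Pav01.
have lim (c : R) : slow tau -> ((c * (#|avoiders tau (n - (l - 1))|%:R /
    #|avoiders tau n|%:R)) @[n --> \oo] --> c / L ^+ (l - 1))%classic.
  by move=> sl; apply: cvgMl_tmp; exact: slow_ratio_cvg.
have up12 n n' a (s : 'S_n') t : ~ tight12 tau -> n.+1 = (n' + l)%N ->
    (a < n')%N -> s \in avoiders tau n' -> t \in [set (1%g : 'S_l)]%SET ->
    infl n a s t \in avoiders tau n.
  move=> nt hn ha hs /set1P ->.
  apply: (@infl_mono_avoid _ _ _ _ _ _ hn l0 ha _ _ true) => //.
    move=> x y xy yl; rewrite (entryE _ (ltn_trans xy yl)) (entryE _ yl).
    by rewrite !perm1.
  exact: no_tight12.
have up21 n n' a (s : 'S_n') t : ~ tight21 tau -> n.+1 = (n' + l)%N ->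
    (a < n')%N -> s \in avoiders tau n' -> t \in [set rever (1%g : 'S_l)]%SET ->
    infl n a s t \in avoiders tau n.
  move=> nt hn ha hs /set1P ->.
  apply: (@infl_mono_avoid _ _ _ _ _ _ hn l0 ha _ _ false) => //.
    move=> x y xy yl; rewrite !reverE //; last by lia.
    have hx : (l.-1 - x < l)%N by lia.
    have hy : (l.-1 - y < l)%N by lia.
    by rewrite (entryE _ hx) (entryE _ hy) !perm1 /=; lia.
  exact: no_tight21.
split.
- move=> hC; have sl : slow tau.
    by case: hC => [/condC1_slow //|[/(condC2_slow hm) //|/condC3_slow //]].
  exact: (limn_sup_le P01 (Pav_le R tau hm hl hk) (lim _ sl)).
- move=> cf; have sl := cluster_free_slow hm cf.
  have main : (P n @[n --> \oo] --> (#|avoiders tau l|%:R / L ^+ (l - 1) : R))%classic.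
    have ll := lim #|avoiders tau l|%:R sl.
    apply: (squeeze_cvgr _ ll ll).
    near=> n; apply/andP; split; near: n; last exact: Pav_le.
    apply: Pav_ge => // n n' a s t hn ha hs ht.
    exact: infl_cluster_free.
  split=> // [lm|lm].
    by rewrite -(card_avoiders_small tau lm).
  have -> : m`!%:R - 1 = #|avoiders tau m|%:R :> R.
    by rewrite -(card_avoiders_self tau) -natr1 addrK.
  have -> : #|avoiders tau m| = #|avoiders tau l| by rewrite lm.
  by rewrite -[in (m - 1)%N]lm.
- split=> [nt|[nt1 nt2]].
    have sl : slow tau by exact: condC1_slow.
    have [t ht] : exists t : 'S_l, forall n n' a (s : 'S_n') t',
        n.+1 = (n' + l)%N -> (a < n')%N -> s \in avoiders tau n' ->
        t' \in [set t]%SET -> infl n a s t' \in avoiders tau n.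
      by case: nt => nt; [exists 1%g|exists (rever 1%g)] => *; [apply: up12|apply: up21].
    have := limn_inf_ge P01 (Pav_ge R hm hl hk ht) (lim _ sl).
    by rewrite cards1.
  have sl : slow tau by apply: condC1_slow; left.
  pose T : {set 'S_l} := [set 1%g; rever 1%g]%SET.
  (* The increasing and the decreasing block already differ in their first entry, because [l] is at
     least 2. *)
  have cT : #|T| = 2%N.
    rewrite cards2; case: eqP => // e; have l1 : (l.-1 < l)%N by lia.
    have := congr1 (fun s : 'S_l => entry s 0) e.
    by rewrite /= reverE // subn0 (entryE _ l0) (entryE _ l1) !perm1 /=; lia.
  have hT n n' a (s : 'S_n') t : n.+1 = (n' + l)%N -> (a < n')%N ->
      s \in avoiders tau n' -> t \in T -> infl n a s t \in avoiders tau n.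
    move=> hn ha hs /set2P [->|->].
      by apply: up12 => //; rewrite finset.in_set1.
    by apply: up21 => //; rewrite finset.in_set1.
  have := limn_inf_ge P01 (Pav_ge R hm hl hk hT) (lim _ sl).
  by rewrite cT.
Unshelve. all: by end_near. Qed.
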